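(* Let $X,Y,K,G,\mathcal B,d_{\mathcal B}$ be as in the context. Let $u_0=\sum_{i=1}^n c_0^i u_0^i$ with $c_0^i>0$ and $u_0^i\in\mathcal B\setminus\{0\}$ for $i=1,\dots,n$, and put $y_0=Ku_0$. Assume that $u_0$ satisfies the Metric Non-Degenerate Source Condition (MNDSC) and that $Ku_0^1,\dots,Ku_0^n$ are linearly independent in $Y$. Then, for every sufficiently small $\varepsilon>0$, there exist $\alpha>0$ and $\lambda_0>0$ such that for all $(\lambda,w)\in N_{\alpha,\lambda_0}$ with $\lambda>0$ the following holds: the problem $$\min_{u\in X}\ \tfrac12\|Ku-y_0-w\|_Y^2+\lambda G(u)$$ has a unique solution $\tilde u_\lambda$, and $\tilde u_\lambda$ admits a unique representation of the form $$\tilde u_\lambda=\sum_{i=1}^n\tilde c_\lambda^i\,\tilde u_\lambda^i,$$ where $\tilde u_\lambda^i\in B_\varepsilon(u_0^i)\setminus\{0\}$, $\langle\tilde\eta_\lambda,\tilde u_\lambda^i\rangle=1$, $\tilde c_\lambda^i>0$ and $|\tilde c_\lambda^i-c_0^i|\le\varepsilon$ for every $i=1,\dots,n$.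
   Context: Setting. $X$ is a real Banach space which is the dual of a separable Banach space $X_*$; $\langle\eta,u\rangle$ is the pairing of $\eta\in X_*$, $u\in X$. $Y$ is a real Hilbert space with scalar product $(\cdot,\cdot)$. $K:X\to Y$ is linear and weak*-to-weak continuous; $K_*:Y\to X_*$ is its (continuous) pre-adjoint, $\langle K_*y,u\rangle=(Ku,y)$. $G:X\to[0,+\infty]$ is convex, weak* lower semicontinuous and positively 1-homogeneous ($G(\lambda u)=\lambda G(u)$ for $\lambda\ge0$, in particular $G(0)=0$). For $u\in X$ with $G(u)<\infty$, $\partial G(u)=\{\eta\in X_*: G(u)+\langle\eta,v-u\rangle\le G(v)\ \forall v\in X\}$. Standing assumptions: the sublevel sets $\{u: G(u)\le a\}$ are weak* compact for every $a\ge0$; $0$ is an interior point of $\partial G(0)$ in $X_*$; $K$ is sequentially weak*-to-strong continuous on $\mathrm{dom}(G)=\{u:G(u)<\infty\}$ (if $u_k\in\mathrm{dom}(G)$ and $u_k\to u$ weak*, then $Ku_k\to Ku$ in norm). Notation: $B=\{u\in X:G(u)\le1\}$, $\mathcal B$ is the weak* closure of the set $\mathrm{Ext}(B)$ of extreme points of $B$, and $d_{\mathcal B}$ is a metric on $\mathcal B$ metrizing weak* convergence on $\mathcal B$; $B_\varepsilon(v)=\{u\in\mathcal B:d_{\mathcal B}(u,v)\le\varepsilon\}$. For $\alpha,\lambda_0>0$: $N_{\alpha,\lambda_0}=\{(\lambda,w)\in\mathbb R_+\times Y: 0\le\lambda\le\lambda_0,\ \|w\|_Y\le\alpha\lambda\}$.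 Dual objects: $\tilde p_\lambda\in Y$ is the unique maximizer of $\lambda(y_0+w,p)-\frac{\lambda^2}{2}\|p\|_Y^2$ over $\{p\in Y:K_*p\in\partial G(0)\}$, and $\tilde\eta_\lambda=K_*\tilde p_\lambda$. When the hard-constrained dual problem $\sup\{(y_0,p):p\in Y,\ K_*p\in\partial G(0)\}$ has a solution, $p_0$ is its solution of minimal norm in $Y$, $\eta_0=K_*p_0$ is the minimal-norm dual certificate, and $\mathrm{Exc}(u_0)=\{u\in\mathcal B:\langle\eta_0,u\rangle=1\}$. Curves: fix $M>0$. $\Gamma_M$ is the set of $\gamma\in C([0,1],\mathcal B)$ (continuous with respect to $d_{\mathcal B}$) such that $t\mapsto K(\gamma(t))$ is $C^2$ on $(0,1)$ and $\sup_t\|\frac{d^2}{dt^2}K(\gamma(t))\|_Y\le M$, where $\frac{d^2}{dt^2}K(\gamma(t))\in Y$ is the second weak Gateaux derivative, so that $\frac{d^2}{dt^2}(p,K(\gamma(t)))=(p,\frac{d^2}{dt^2}K(\gamma(t)))$ for all $p\in Y$. MNDSC: $u_0=\sum_{i=1}^n c_0^iu_0^i$ with $y_0=Ku_0$ satisfies the MNDSC if (i) $\mathrm{Im}\,K_*\cap\partial G(u_0)\ne\emptyset$ (this guarantees that the hard-constrained dual problem has a solution, so $\eta_0$ exists); (ii) $\mathrm{Exc}(u_0)=\{u_0^1,\dots,u_0^n\}$; (iii) there exist $\varepsilon,\delta>0$ such that for all $i=1,\dots,n$ and all $v_1\ne v_2$ in $B_\varepsilon(u_0^i)$ there is a curve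 $\gamma:[0,1]\to B_\varepsilon(u_0^i)$ in $\Gamma_M$ with $\gamma(0)=v_1$, $\gamma(1)=v_2$ and $\frac{d^2}{dt^2}\langle\eta_0,\gamma(t)\rangle<-\delta$ for all $t\in(0,1)$. *)

(* Defs.v *)
From mathcomp Require Import all_boot all_order all_algebra sesquilinear.
From mathcomp Require Import all_classical all_reals all_analysis.

Set Implicit Arguments.
Unset Strict Implicit.
Unset Printing Implicit Defensive.

Import Order.TTheory GRing.Theory Num.Theory.
Import numFieldNormedType.Exports.

Local Open Scope classical_set_scope.
Local Open Scope ring_scope.

Definition separable (T : topologicalType) : Prop :=
  exists2 D : set T, countable D & dense D.

Definition lin_indep (R : realType) (V : lmodType R) (n : nat)
    (v : 'I_n -> V) : Prop :=
  forall a : 'I_n -> R, \sum_(i < n) a i *: v i = 0 -> forall i, a i = 0.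

Definition extreme_points (R : realType) (V : lmodType R) (A : set V) : set V :=
  [set u | A u /\ forall v w (t : R), A v -> A w -> 0 < t < 1 ->
                    u = t *: v + (1 - t) *: w -> v = u /\ w = u].

Definition convex_efun (R : realType) (V : lmodType R) (G : V -> \bar R) : Prop :=
  forall u v (t : R), 0 <= t <= 1 ->
    (G (t *: u + (1 - t) *: v)%R <= t%:E * G u + (1 - t)%R%:E * G v)%E.

(* With the convention [0 * +oo = 0] of [\bar R], the case [lam = 0] says
   [G 0 = 0]. *)
Definition pos_homogeneous (R : realType) (V : lmodType R) (G : V -> \bar R) : Prop :=
  forall (lam : R) u, 0 <= lam -> G (lam *: u) = (lam%:E * G u)%E.

(* Symmetry and positivity are part of [{dot Y for idfun}], completeness is part
   of the type of [Y]. *)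
Definition hilbert (R : realType) (Y : completeNormedModType R)
    (dot : {dot Y for idfun}) : Prop :=
  forall y : Y, dot y y = `|y| ^+ 2.

Section WeakTopologies.
Variable R : realType.

(* [u |-> pr ^~ u] is an isometric isomorphism of [X] onto the dual of [E]. *)
Definition dual_pairing (E X : normedModType R)
    (pr : {bilinear E -> X -> R | *%R & *%R}) : Prop :=
  (forall u : X,
     (`|u|)%:E = ereal_sup [set (`|pr eta u|)%:E | eta in [set eta : E | `|eta| <= 1]])
  /\ (forall f : {scalar E}, continuous (f : E -> R) ->
        exists u : X, forall eta : E, pr eta u = f eta).

Definition weak_star (E X : normedModType R) (pr : E -> X -> R) : topologicalType :=
  initial_topology (fun u : X => (pr ^~ u : {ptws E -> R})).

Definition continuous_dual (V : normedModType R) : Type :=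
  {f : {scalar V} | continuous (f : V -> R)}.

Definition weak (V : normedModType R) : topologicalType :=
  initial_topology
    (fun v : V => ((fun f => sval f v) : {ptws continuous_dual V -> R})).

Definition metric_on (T : Type) (A : set T) (d : T -> T -> R) : Prop :=
  [/\ forall u v, A u -> A v -> 0 <= d u v,
      forall u v, A u -> A v -> d u v = 0 <-> u = v,
      forall u v, A u -> A v -> d u v = d v u
    & forall u v w, A u -> A v -> A w -> d u w <= d u v + d v w].

(* Convergence is that of arbitrary proper filters (equivalently, nets), so
   [d] induces on [A] the subspace topology of [T]. *)
Definition metrizes_on (T : topologicalType) (A : set T) (d : T -> T -> R) : Prop :=
  metric_on A d /\
  forall (F : set_system T) (u : T), ProperFilter F -> F A -> A u ->
    (F --> u) <-> (d v u @[v --> F] --> (0 : R)).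

End WeakTopologies.

Section Setting.
Variables (R : realType) (E X Y : completeNormedModType R).
Variable pr : {bilinear E -> X -> R | *%R & *%R}.
Variable dot : {dot Y for idfun}.
Variables (K : {linear X -> Y}) (Ks : {linear Y -> E}) (G : X -> \bar R).

(* No guard [G u < +oo] is needed: if [G u = +oo] and [G 0 = 0] the set is
   empty. *)
Definition subdiff (u : X) : set E :=
  [set eta | forall v : X, (G u + (pr eta (v - u)%R)%:E <= G v)%E].

Definition unit_sublevel : set X := [set u | (G u <= 1)%E].

Definition ext_closure : set X :=
  closure (extreme_points unit_sublevel : set (weak_star pr)).

Definition primal_obj (y0 w : Y) (lam : R) (u : X) : \bar R :=
  ((2^-1 * `|K u - y0 - w| ^+ 2)%R%:E + lam%:E * G u)%E.

Definition primal_sol (y0 w : Y) (lam : R) : set X :=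
  [set u | forall v, (primal_obj y0 w lam u <= primal_obj y0 w lam v)%E].

Definition dual_feasible : set Y := [set p | subdiff 0 (Ks p)].

Definition dual_obj (y0 w : Y) (lam : R) (p : Y) : R :=
  lam * dot (y0 + w) p - lam ^+ 2 / 2 * `|p| ^+ 2.

Definition dual_sol (y0 w : Y) (lam : R) : set Y :=
  [set p | dual_feasible p /\
           forall q, dual_feasible q -> dual_obj y0 w lam q <= dual_obj y0 w lam p].

(* For [0 < lam] the maximizer exists and is unique (strongly concave objective,
   closed convex feasible set containing [0]), so the default [0] is not used. *)
Definition p_tilde (y0 w : Y) (lam : R) : Y := xget 0 (dual_sol y0 w lam).

Definition eta_tilde (y0 w : Y) (lam : R) : E := Ks (p_tilde y0 w lam).

Definition hard_dual_sol (y0 : Y) : set Y :=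
  [set p | dual_feasible p /\ forall q, dual_feasible q -> dot y0 q <= dot y0 p].

Definition min_norm_dual_sol (y0 : Y) : set Y :=
  [set p | hard_dual_sol y0 p /\ forall q, hard_dual_sol y0 q -> `|p| <= `|q|].

(* Well defined as soon as [hard_dual_sol y0] is nonempty, which condition (i) of
   [MNDSC] ensures: a nonempty closed convex set has one element of minimal
   norm. *)
Definition p_zero (y0 : Y) : Y := xget 0 (min_norm_dual_sol y0).

Definition eta_zero (y0 : Y) : E := Ks (p_zero y0).

Definition Exc (y0 : Y) : set X :=
  [set u | ext_closure u /\ pr (eta_zero y0) u = 1].

Definition noise_set (alpha lam0 : R) : set (R * Y) :=
  [set lw | 0 <= lw.1 <= lam0 /\ `|lw.2| <= alpha * lw.1].

(* The weak Gateaux derivative on the open interval (0, 1), characterized by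
   d/dt (p, f t) = (p, f' t) for all [p]. *)
Definition weak_derivative (f f' : R -> Y) : Prop :=
  forall (p : Y) (t : R), 0 < t < 1 ->
    is_derive t (1 : R) (fun s => dot p (f s) : R) (dot p (f' t)).

Section Curves.
Variable d : X -> X -> R.

Definition closed_ball_ext (v : X) (eps : R) : set X :=
  [set u | ext_closure u /\ d u v <= eps].

(* A curve on [0, 1] is a function on [R] of which only the values on [0, 1]
   are constrained. C^2 is meant in the weak sense: this allows more curves than
   norm-C^2, hence makes [MNDSC] a weaker assumption. *)
Definition Gamma (M : R) : set (R -> X) :=
  [set gamma : R -> X |
    [/\ forall t : R, 0 <= t <= 1 -> ext_closure (gamma t),
        forall t : R, 0 <= t <= 1 ->
          d (gamma s) (gamma t) @[s --> within `[0, 1] (nbhs t)] --> (0 : R)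
      & exists f1 f2 : R -> Y,
          [/\ weak_derivative (K \o gamma) f1,
              weak_derivative f1 f2,
              forall (p : Y) (t : R), 0 < t < 1 ->
                {for t, continuous (fun s => dot p (f2 s) : R)}
            & forall t : R, 0 < t < 1 -> `|f2 t| <= M]]].

Definition MNDSC (M : R) (n : nat) (u0 : X) (u0i : 'I_n -> X) : Prop :=
  let y0 := K u0 in
  [/\ (range Ks `&` subdiff u0) !=set0,
      Exc y0 = range u0i
    & exists eps delta : R,
        [/\ 0 < eps, 0 < delta &
            forall (i : 'I_n) (v1 v2 : X),
              closed_ball_ext (u0i i) eps v1 ->
              closed_ball_ext (u0i i) eps v2 -> v1 <> v2 ->
              exists gamma : R -> X,
                [/\ Gamma M gamma,
                    forall t : R, 0 <= t <= 1 -> closed_ball_ext (u0i i) eps (gamma t),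
                    gamma 0 = v1, gamma 1 = v2
                  & forall t : R, 0 < t < 1 ->
                      derive1n 2 (fun s : R => pr (eta_zero y0) (gamma s) : R) t < - delta]]].

(* [cv] packs the coefficients and the atoms of a representation of [u]. *)
Definition sparse_rep (eta : E) (eps : R) (n : nat) (c0 : 'I_n -> R)
    (u0i : 'I_n -> X) (u : X) : set (('I_n -> R) * ('I_n -> X)) :=
  [set cv |
    u = \sum_(i < n) cv.1 i *: cv.2 i /\
    forall i,
      [/\ closed_ball_ext (u0i i) eps (cv.2 i), cv.2 i <> 0,
          pr eta (cv.2 i) = 1, 0 < cv.1 i & `|cv.1 i - c0 i| <= eps]].

End Curves.
End Setting.

(* Main.v *)
Require Import Defs.
From mathcomp Require Import all_boot all_order all_algebra sesquilinear.
From mathcomp Require Import all_classical all_reals all_analysis.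
From mathcomp Require Import ring lra.

Set Implicit Arguments.
Unset Strict Implicit.
Unset Printing Implicit Defensive.

Import Order.TTheory GRing.Theory Num.Theory.
Import numFieldNormedType.Exports.

Local Open Scope classical_set_scope.
Local Open Scope ring_scope.

(** Write C for the set of feasible dual variables, those [p] with
<Ks p, v> <= G v for all [v].  A minimizer [u] of the primal problem satisfies
Ks p in dG(u) for p = (y0 + w - K u) / lam ([primal_subdiff]).  By positive
homogeneity of [G] this means that [p] is feasible and <Ks p, u> = G u
([subdiff_hom]), so [p] is the metric projection of (y0 + w) / lam onto C, that
is [p_tilde] ([primal_dual]).  All minimizers thus share the value of [K u] and
lie in the cone over the face of B = {G <= 1} on which [eta_tilde] equals 1.

As lam tends to 0 and |w| / lam stays small, the projections [p_tilde] converge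
to the minimal-norm solution [p_zero] of the hard-constrained dual problem
([reg_vi_cvg], [certificates_cvg]).  This controls the points of the weak*
closure of Ext B at which [eta_tilde] equals 1, called atoms here, in two ways.
- By compactness [eta_zero] stays away from 1 outside neighbourhoods of the
  [u0i i], so each atom is close to some [u0i i] ([localisation]).
- Along the curves of the source condition the second derivative of
  <eta_tilde, gamma t> is below - delta + M |p_tilde - p_zero|, hence negative
  for small lam; two atoms in one ball would force a value above 1 in between
  them ([one_atom_per_ball]).
So there is at most one atom near each [u0i i].

The face of B on which [eta_tilde] equals 1 is weak* compact and its extreme
points are extreme in B, hence atoms.  A Krein-Milman argument for finitely many
extreme points then writes every minimizer as a nonnegative combination of the
atoms ([weak_star_krein_milman], [atomic_decomposition]).  The images under [K]
of the atoms are close to the independent vectors [K (u0i i)], so they are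
independent with a uniform constant ([coercive_perturb]).  Together with
K u = y0 + w - lam p_tilde this makes the coefficients unique and close to
[c0 i], hence positive: every ball contains an atom, and both the minimizer and
its representation are unique. *)

(** * Projections onto a convex set of a Hilbert space, as the parameter vanishes *)

Section Hilbert.
Context (R : realType) (Y : completeNormedModType R) (dot : {dot Y for idfun}).
Hypothesis Y_hilbert : hilbert dot.
Implicit Types (x y p q z : Y).

Lemma dotC x y : dot x y = dot y x.
Proof. by rewrite hermC expr0 mul1r. Qed.

Lemma dot_norm x : dot x x = `|x| ^+ 2.
Proof. exact: Y_hilbert. Qed.

Lemma dotDl x y z : dot (x + y) z = dot x z + dot y z.
Proof. exact: (linearDl dot z). Qed.
Lemma dotBl x y z : dot (x - y) z = dot x z - dot y z.
Proof. exact: (linearBl dot z). Qed.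
Lemma dotZl (a : R) x z : dot (a *: x) z = a * dot x z.
Proof. exact: (linearZl_LR dot z). Qed.
Lemma dotDr x y z : dot z (x + y) = dot z x + dot z y.
Proof. by rewrite dotC dotDl !(dotC _ z). Qed.
Lemma dotBr x y z : dot z (x - y) = dot z x - dot z y.
Proof. by rewrite dotC dotBl !(dotC _ z). Qed.
Lemma dotZr (a : R) x z : dot z (a *: x) = a * dot z x.
Proof. by rewrite dotC dotZl (dotC x). Qed.

Lemma normB_sqr x y : `|x - y| ^+ 2 = `|x| ^+ 2 - 2 * dot x y + `|y| ^+ 2.
Proof. by rewrite -!dot_norm dotBl !dotBr (dotC y x); ring. Qed.

(** The triangle inequality for [x - y], squared, is the Cauchy-Schwarz
inequality. *)
Lemma dot_le x y : dot x y <= `|x| * `|y|.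
Proof.
have h : `|x - y| ^+ 2 >= (`|x| - `|y|) ^+ 2.
  rewrite -[leLHS]real_normK ?num_real // ler_pXn2r ?nnegrE //; exact: ler_dist_dist.
by move: h; rewrite normB_sqr sqrrB; lra.
Qed.

Lemma dot_abs_le x y : `|dot x y| <= `|x| * `|y|.
Proof.
rewrite ler_norml dot_le andbT lerNl.
by have := dot_le ((-1) *: x) y; rewrite dotZl normrZ normrN1 mul1r mulN1r.
Qed.

Lemma dot_cvgr (T : Type) (F : set_system T) (FF : Filter F) (f : T -> Y) y z :
  f t @[t --> F] --> y -> dot z (f t) @[t --> F] --> dot z y.
Proof.
move=> fy; apply/cvgrPdist_le => e e0.
have z0 : 0 < `|z| + 1 by rewrite ltr_wpDl.
have /cvgrPdist_le/(_ (e / (`|z| + 1))) := fy.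
rewrite divr_gt0// => /(_ isT); apply: filterS => t yt.
rewrite -dotBr (le_trans (dot_abs_le _ _))//.
apply: (@le_trans _ _ ((`|z| + 1) * `|y - f t|)).
  by apply: ler_wpM2r => //; rewrite lerDl.
by rewrite mulrC -ler_pdivlMr.
Qed.

(** The variational inequality that characterizes [p] as the projection of
[lam^-1 *: z] onto a closed convex [C]; scaled by [lam], it still makes sense in the limit
[lam = 0], where it says that [p] maximizes [dot z] over [C]. *)
Definition reg_vi (C : set Y) z (lam : R) p :=
  C p /\ forall q, C q -> dot (z - lam *: p) (q - p) <= 0.

Variable C : set Y.

(** Projections onto a convex set are nonexpansive. *)
Lemma reg_vi_lip z w lam p p' : 0 < lam ->
  reg_vi C z lam p -> reg_vi C (z + w) lam p' -> `|p' - p| <= `|w| / lam.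
Proof.
move=> l0 [Cp h] [Cp' h'].
have := h _ Cp'; have := h' _ Cp.
have [->|ne] := eqVneq p' p; first by rewrite subrr normr0 divr_ge0 // ltW.
have n0 : 0 < `|p' - p| by rewrite normr_gt0 subr_eq0.
have e : dot (z - lam *: p) (p' - p) + dot (z + w - lam *: p') (p - p')
       = lam * `|p' - p| ^+ 2 - dot w (p' - p).
  rewrite -dot_norm !(dotBl, dotBr, dotDl, dotDr, dotZl, dotZr).
  ring.
have := dot_le w (p' - p) => d1 h1 h2.
rewrite ler_pdivlMr // -(ler_pM2r n0).
by move: e d1 h1 h2; rewrite expr2; lra.
Qed.

(** Testing each of the two inequalities with the other point gives
(mu - lam) (|q|^2 - |p|^2) + (mu + lam) |p - q|^2 <= 0.  So the norm increases as
the parameter decreases, and it controls the distance between projections. *)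
Lemma reg_vi_monotone z lam mu p q : 0 < lam -> lam <= mu ->
  reg_vi C z lam p -> reg_vi C z mu q -> `|p - q| ^+ 2 <= `|p| ^+ 2 - `|q| ^+ 2.
Proof.
move=> l0 lm [Cp h] [Cq h'].
have [->|ne] := eqVneq p q; first by rewrite !subrr normr0 expr0n.
have := h _ Cq; have := h' _ Cp.
have := normB_sqr p q.
have : 0 < `|p - q| ^+ 2 by rewrite exprn_gt0 // normr_gt0 subr_eq0.
rewrite !(dotBl, dotBr, dotDl, dotDr, dotZl, dotZr) -!dot_norm (dotC q p).
set a := dot p p; set b := dot q q; set c := dot p q; set e := dot _ _.
move=> e0 eE h1 h2.
have h3 : (mu - lam) * (b - a) + (mu + lam) * e <= 0 by rewrite eE; nra.
have [//|h4] := leP e (a - b).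
have h5 : (mu - lam) * (a - b) <= (mu - lam) * e.
  by apply: ler_wpM2l; [rewrite subr_ge0 | exact: ltW].
have h6 : 0 < lam * e by exact: mulr_gt0.
lra.
Qed.

Definition hard_sol z p := C p /\ forall q, C q -> dot z q <= dot z p.

(** The limit case [lam = 0] of [reg_vi_monotone]. *)
Lemma reg_vi_hard z lam p q : 0 < lam ->
  reg_vi C z lam p -> hard_sol z q -> `|p - q| ^+ 2 <= `|q| ^+ 2 - `|p| ^+ 2.
Proof.
move=> l0 [Cp h] [Cq h'].
have := h _ Cq; have := h' _ Cp.
rewrite normB_sqr !(dotBl, dotBr, dotDl, dotDr, dotZl, dotZr) -!dot_norm.
nra.
Qed.

(** As [lam] decreases to 0, the norms of the projections increase and stay below
the norm of every solution of the hard-constrained problem.  By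
[reg_vi_monotone] the projections form a Cauchy family, and their limit is a
solution of minimal norm.  Since [reg_vi_hard] bounds the distance to any
solution by a difference of squared norms, no other solution has minimal norm. *)
Lemma reg_vi_cvg z :
  (forall (v : nat -> Y) v0, (forall k, C (v k)) -> v k @[k --> \oo] --> v0 -> C v0) ->
  (forall lam, 0 < lam -> exists p, reg_vi C z lam p) ->
  (exists p, hard_sol z p) ->
  exists p0, [/\ hard_sol z p0, forall q, hard_sol z q -> `|p0| <= `|q| &
    forall q, hard_sol z q -> `|q| <= `|p0| -> q = p0] /\
    forall e, 0 < e -> exists2 lam0, 0 < lam0 & forall lam p, 0 < lam <= lam0 ->
      reg_vi C z lam p -> `|p - p0| <= e.
Proof.
move=> Ccl ex [ps hs].
(* It suffices to follow one sequence of parameters: [reg_vi_monotone] compares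
   any smaller parameter with its terms. *)
pose l k : R := k.+1%:R^-1.
have l0 k : 0 < l k by rewrite invr_gt0 ltr0n.
have /choice [P hP] : forall k, exists p, reg_vi C z (l k) p by move=> k; exact: ex.
have lel j k : (j <= k)%N -> l k <= l j.
  by move=> jk; rewrite lef_pV2 ?posrE ?ltr0n // ler_nat.
have mono j k : (j <= k)%N -> `|P k - P j| ^+ 2 <= `|P k| ^+ 2 - `|P j| ^+ 2.
  by move=> jk; apply: (reg_vi_monotone _ (lel _ _ jk) (hP k) (hP j)).
have ndec : nondecreasing_seq (fun k => `|P k| ^+ 2).
  by move=> j k jk; have := mono _ _ jk; have := sqr_ge0 `|P k - P j|; lra.
have leh q k : hard_sol z q -> `|P k| ^+ 2 <= `|q| ^+ 2.
  by move=> hq; have := reg_vi_hard (l0 k) (hP k) hq; have := sqr_ge0 `|P k - q|; lra.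
have bnd : has_ubound (range (fun k => `|P k| ^+ 2)).
  by exists (`|ps| ^+ 2) => _ [k _ <-]; exact: leh.
have cn := nondecreasing_is_cvgn ndec bnd.
set N := limn _ in cn.
have cN k : `|P k| ^+ 2 <= N by exact: (nondecreasing_cvgn_le ndec cn k).
have cau : cauchy (P @ \oo).
  apply/cauchy_ballP => e e0.
  have e20 : 0 < (e / 2) ^+ 2 by rewrite exprn_gt0 // divr_gt0.
  have /cvgrPdist_lt/(_ _ e20) := cn.
  case=> k0 _ /(_ k0 (leqnn _)) /= hk0.
  exists (P @` [set k | (k0 <= k)%N], P @` [set k | (k0 <= k)%N]) => /=.
    by split; exists k0 => // k kk; exists k.
  have near0 k : (k0 <= k)%N -> `|P k - P k0| < e / 2.
    move=> kk; rewrite -(@ltr_pXn2r _ 2) ?nnegrE ?divr_ge0 // ?(ltW e0) //.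
    apply: le_lt_trans (mono _ _ kk) _; apply: le_lt_trans hk0.
    by rewrite ger0_norm ?subr_ge0 // lerB.
  move=> [_ _] [/= [j jk <-] [k kk <-]].
  rewrite -ball_normE /=.
  have -> : P j - P k = (P j - P k0) - (P k - P k0) by rewrite opprB addrA subrK.
  by apply: le_lt_trans (ler_normB _ _) _; have := near0 _ jk; have := near0 _ kk; lra.
have [ph cP'] : exists ph : Y, P k @[k --> \oo] --> ph.
  by apply/cvg_ex/cauchy_cvgP.
have Nph : `|ph| ^+ 2 = N.
  by apply/esym/cvg_lim => //; rewrite expr2; under eq_fun do rewrite expr2;
    apply: cvgM; apply: cvg_norm.
have minph q : hard_sol z q -> `|ph| ^+ 2 <= `|q| ^+ 2.
  move=> hq; rewrite Nph; apply: limr_le => //.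
  by apply: nearW => k; exact: leh.
have hph : hard_sol z ph.
  split; first by apply: Ccl cP' => k; case: (hP k).
  move=> q Cq; apply: le_trans (hs.2 _ Cq) _.
  have le1 k : dot z ps <= dot z (P k) + l k * `|ps| ^+ 2.
    have := (hP k).2 _ hs.1; have := leh _ k hs.
    rewrite dotBl !dotBr !dotZl dot_norm => h1 h2.
    have := normB_sqr (P k) ps; have := sqr_ge0 `|P k - ps| => h3 h4.
    have h5 : l k * (dot (P k) ps - `|P k| ^+ 2) <= l k * `|ps| ^+ 2.
      apply: ler_wpM2l; first exact: ltW.
      have := sqr_ge0 `|P k|; lra.
    lra.
  have c1 : dot z (P k) + l k * `|ps| ^+ 2 @[k --> \oo] --> dot z ph + 0 * `|ps| ^+ 2.
    apply: cvgD; first exact: dot_cvgr.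
    by apply: cvgM; [exact: cvg_harmonic | exact: cvg_cst].
  rewrite mul0r addr0 in c1.
  rewrite -(cvg_lim _ c1) //; apply: limr_ge; first by apply/cvg_ex; eexists; exact: c1.
  by apply: nearW.
exists ph; split.
  split => // q hq.
  - by rewrite -(@ler_pXn2r _ 2) ?nnegrE // minph.
  move=> le; apply: (@cvg_unique _ _ (P @ \oo)); first exact: norm_hausdorff.
    apply/cvgrPdist_lt => e e0.
    have e20 : 0 < e ^+ 2 by rewrite exprn_gt0.
    have /cvgrPdist_lt/(_ _ e20) := cn.
    apply: filterS => k; rewrite -Nph ger0_norm; last by rewrite Nph subr_ge0.
    move=> hk; rewrite distrC -(@ltr_pXn2r _ 2) ?nnegrE // ?(ltW e0) //.
    apply: le_lt_trans (reg_vi_hard (l0 k) (hP k) hq) _; apply: le_lt_trans hk.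
    by rewrite lerB // ler_pXn2r ?nnegrE.
  exact: cP'.
move=> e e0; have e20 : 0 < e ^+ 2 by rewrite exprn_gt0.
have /cvgrPdist_lt/(_ _ e20) := cn.
case=> k0 _ /(_ k0 (leqnn _)) /= hk0.
exists (l k0) => // lam p /andP[lam0 laml] hp.
rewrite -(@ler_pXn2r _ 2) ?nnegrE // ?(ltW e0) //.
apply: le_trans (reg_vi_hard lam0 hp hph) _.
have := reg_vi_monotone lam0 laml hp (hP k0); have := sqr_ge0 `|p - P k0|.
move: hk0; rewrite ger0_norm ?subr_ge0 // Nph; lra.
Qed.

End Hilbert.

(** * Compactness, and convex hulls of finitely many extreme points *)

(** The superlevel sets of [f] over values taken on [S] form a filter base; a
cluster point where [f] is not maximal would have a neighbourhood missing one of
them. *)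
Lemma usc_compact_max (R : realType) (T : topologicalType) (S : set T) (f : T -> R) :
  compact S -> S !=set0 ->
  (forall x, S x -> forall e, 0 < e -> \forall y \near x, S y -> f y < f x + e) ->
  exists2 x, S x & forall y, S y -> f y <= f x.
Proof.
move=> cS [x0 Sx0] usc; apply: contrapT => nmax.
have up x : S x -> exists2 y, S y & f x < f y.
  move=> Sx; apply: contrapT => h; apply: nmax; exists x => // y Sy.
  by rewrite leNgt; apply/negP => xy; apply: h; exists y.
pose B x := [set y | S y /\ f x <= f y].
have FF : ProperFilter (filter_from S B).
  apply: filter_from_proper; last by move=> x Sx; exists x; split.
  apply: filter_from_filter; first by exists x0.
  move=> x y Sx Sy; have [xy|yx] := leP (f x) (f y).
    by exists y => // t [St yt]; split; split => //; exact: le_trans yt.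
  by exists x => // t [St xt]; split; split => //; exact: le_trans (ltW yx) xt.
have [|z [Sz clz]] := cS _ FF; first by exists x0 => // y [].
have [y Sy zy] := up _ Sz.
have := usc z Sz (f y - f z); rewrite subr_gt0 => /(_ zy) nz.
have Fy : filter_from S B (B y) by exists y.
have [t [[St yt] /(_ St)]] := clz _ _ Fy nz.
by rewrite addrC subrK ltNge yt.
Qed.

Lemma cube_compact (R : realType) n (A : set 'rV[R]_n) (r : R) :
  closed A -> (forall c, A c -> forall i, `|c ord0 i| <= r) -> compact A.
Proof.
move=> cA bA; apply: (subclosed_compact cA (B :=
  [set c : 'rV[R]_n | forall i, `[- r, r]%classic (c ord0 i)])).
  exact: (@rV_compact R n (fun=> `[- r, r]%classic) (fun=> @segment_compact _ _ _)).
by move=> c Ac i /=; rewrite in_itv /= -ler_norml bA.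
Qed.

Lemma continuous_usc (R : realType) (T : topologicalType) (f : T -> R) x e :
  {for x, continuous f} -> 0 < e -> \forall y \near x, f y < f x + e.
Proof.
move=> /cvgrPdist_lt cf e0; have := cf e e0; apply: filterS => y.
by rewrite distrC ltr_distl => /andP[].
Qed.

Lemma lin_comb_continuous (R : realType) (V : normedModType R) n (a : 'I_n -> V) :
  continuous (fun c : 'rV[R]_n => \sum_(i < n) c ord0 i *: a i).
Proof.
apply: continuous_big; first exact: add_continuous.
move=> i _ c; exact: (cvgZr_tmp (@coord_continuous R 1 n ord0 i c)).
Qed.

Lemma sum_norm_continuous (R : realType) n :
  continuous (fun c : 'rV[R]_n => \sum_(i < n) `|c ord0 i|).
Proof.
apply: continuous_big; first exact: add_continuous.
by move=> i _ c; exact: (cvg_norm (@coord_continuous R 1 n ord0 i c)).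
Qed.

Lemma sum_coord_continuous (R : realType) n :
  continuous (fun c : 'rV[R]_n => \sum_(i < n) c ord0 i).
Proof.
apply: continuous_big; first exact: add_continuous.
by move=> i _ c; exact: coord_continuous.
Qed.

Lemma closed_level (R : realType) (T : topologicalType) (f : T -> R) r :
  continuous f -> closed [set x | f x = r].
Proof.
by move=> cf; apply: (@preimage_closed _ _ f [set r]) => // x _; exact: cf.
Qed.

(** The minimum of |sum c_i a_i| over the unit sphere of the l^1 norm is attained
and positive. *)
Lemma lin_indep_coercive (R : realType) (V : normedModType R) n (a : 'I_n -> V) :
  lin_indep a -> exists2 k : R, 0 < k &
    forall c : 'I_n -> R, k * (\sum_i `|c i|) <= `|\sum_i c i *: a i|.
Proof.
move=> indep.
pose S := [set c : 'rV[R]_n | \sum_(i < n) `|c ord0 i| = 1].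
have cS : compact S.
  apply: (@cube_compact _ _ _ 1).
    by apply: closed_level; exact: sum_norm_continuous.
  move=> c <- i; rewrite (bigD1 i) //= lerDl.
  by apply: sumr_ge0.
have nrm (c : 'I_n -> R) : \sum_i `|c i| != 0 ->
    S (\row_i ((\sum_i `|c i|)^-1 * c i)).
  move=> s0; rewrite /S /=; under eq_bigr do rewrite mxE normrM ger0_norm ?invr_ge0 ?sumr_ge0//.
  by rewrite -mulr_sumr mulVf.
have [S0|/set0P/negP/negPn/eqP S0] := pselect (S !=set0); last first.
  exists 1 => // c; have [->|/nrm] := eqVneq (\sum_i `|c i|) 0.
    by rewrite mulr0.
  by rewrite S0.
have cf : continuous (fun c : 'rV[R]_n => `|\sum_i c ord0 i *: a i|).
  by move=> c; exact: (cvg_norm (@lin_comb_continuous _ _ _ a c)).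
have [c /set_mem Sc cmin] := compact_EVT_min S0 cS (continuous_subspaceT cf).
exists `|\sum_i c ord0 i *: a i|.
  rewrite normr_gt0; apply/eqP => /indep c0; move: Sc; rewrite /S /=.
  by rewrite big1 => [/esym/eqP|i _]; rewrite ?oner_eq0 // c0 normr0.
move=> c'; have [->|s0] := eqVneq (\sum_i `|c' i|) 0; first by rewrite mulr0.
have sp : 0 < \sum_i `|c' i| by rewrite lt_neqAle eq_sym s0 sumr_ge0.
have := cmin _ (mem_set (nrm _ s0)).
under [X in _ <= `|X|]eq_bigr do rewrite mxE -scalerA.
by rewrite -scaler_sumr normrZ ger0_norm ?invr_ge0 ?(ltW sp) // ler_pdivlMl // mulrC.
Qed.

Section InnerForm.
Context (R : realType) (V : lmodType R) (q : V -> V -> R).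

Definition inner_form :=
  [/\ forall (a : R) x y z, q (a *: x + y) z = a * q x z + q y z,
      forall x y, q x y = q y x & forall x, x != 0 -> 0 < q x x].

Hypothesis iq : inner_form.

Lemma qC x y : q x y = q y x. Proof. by case: iq. Qed.
Lemma qPl (a : R) x y z : q (a *: x + y) z = a * q x z + q y z.
Proof. by case: iq. Qed.
Lemma q0l z : q 0 z = 0.
Proof. by have := qPl 1 0 0 z; rewrite scaler0 addr0 mul1r; lra. Qed.
Lemma qZl (a : R) x z : q (a *: x) z = a * q x z.
Proof. by have := qPl a x 0 z; rewrite addr0 q0l addr0. Qed.
Lemma qDl x y z : q (x + y) z = q x z + q y z.
Proof. by have := qPl 1 x y z; rewrite scale1r mul1r. Qed.
Lemma qBl x y z : q (x - y) z = q x z - q y z.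
Proof. by rewrite qDl -scaleN1r qZl mulN1r. Qed.
Lemma qZr (a : R) x z : q z (a *: x) = a * q z x.
Proof. by rewrite qC qZl qC. Qed.
Lemma qDr x y z : q z (x + y) = q z x + q z y.
Proof. by rewrite qC qDl !(qC z). Qed.
Lemma qBr x y z : q z (x - y) = q z x - q z y.
Proof. by rewrite qC qBl !(qC z). Qed.
Lemma q_suml n (a : 'I_n -> V) z : q (\sum_i a i) z = \sum_i q (a i) z.
Proof. by apply: (big_morph (q^~ z)) => [x y|]; rewrite ?qDl ?q0l. Qed.
Lemma q_ge0 x : 0 <= q x x.
Proof.
by have [->|x0] := eqVneq x 0; [rewrite q0l | case: iq => _ _ /(_ _ x0)/ltW].
Qed.

(** Parallelogram identity: the squared distance to [z] is strictly convex, so it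
is not maximal inside a nondegenerate segment. *)
Lemma farthest_extreme (F : set V) z x : F x ->
  (forall y, F y -> q (y - z) (y - z) <= q (x - z) (x - z)) -> extreme_points F x.
Proof.
move=> Fx far; split => // v w t Fv Fw /andP[t0 t1] xE.
have [vw|vw] := eqVneq v w.
  by move: xE; rewrite vw -scalerDl addrC subrK scale1r.
have vw0 : 0 < q (v - w) (v - w) by case: iq => _ _; apply; rewrite subr_eq0.
have := far _ Fv; have := far _ Fw.
have -> : q (x - z) (x - z) = t * q (v - z) (v - z) + (1 - t) * q (w - z) (w - z)
   - t * (1 - t) * q (v - w) (v - w).
  have -> : x - z = t *: (v - w) + (w - z).
    by rewrite xE scalerBl scale1r scalerBr !addrA (addrAC (t *: v) w).
  have -> : v - z = (v - w) + (w - z) by rewrite addrA subrK.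
  move: (v - w) (w - z) => a b.
  by rewrite !(qDl, qDr, qZl, qZr) (qC b a); ring.
have : 0 < t * (1 - t) * q (v - w) (v - w) by rewrite !mulr_gt0 // subr_gt0.
set A := q (v - z) _; set B := q (w - z) _; set C := _ * q (v - w) _ => C0 h1 h2.
have h3 : (1 - t) * (t * B + (1 - t) * B) <= (1 - t) * (t * A + (1 - t) * B - C).
  by apply: ler_wpM2l; [rewrite subr_ge0 ltW | lra].
have h4 : t * (t * A + (1 - t) * A) <= t * (t * A + (1 - t) * B - C).
  by apply: ler_wpM2l; [rewrite ltW | lra].
exfalso; lra.
Qed.

(** The point of the convex hull of the [a i] nearest to [u]; the angle condition
is the first-order condition along the segments towards the [a j].  The index
[i0] makes the hull nonempty. *)
Lemma conv_nearest n (a : 'I_n -> V) (u : V) (i0 : 'I_n) :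
  exists c : 'I_n -> R, [/\ forall i, 0 <= c i, \sum_i c i = 1 &
    let s := \sum_i c i *: a i in forall j, q (u - s) (a j - s) <= 0].
Proof.
pose S := [set c : 'rV[R]_n | (forall i, 0 <= c ord0 i) /\ \sum_i c ord0 i = 1].
have Sle c : S c -> forall i, c ord0 i <= 1.
  move=> [c0 <-] i; rewrite (bigD1 i) //= lerDl.
  by apply: sumr_ge0.
have cS : compact S.
  apply: (@cube_compact _ _ _ 1); last first.
    by move=> c Sc i; rewrite ger0_norm ?Sle //; case: Sc.
  rewrite (_ : S = (\bigcap_i [set c : 'rV[R]_n | 0 <= c ord0 i]) `&`
                   [set c | \sum_i c ord0 i = 1]); last first.
    apply/seteqP; split => c /= [h1 h2]; split => // i; first by move=> _; exact: h1.
    exact: h1.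
  apply: closedI; last by apply: closed_level; exact: sum_coord_continuous.
  apply: closed_bigI => i _.
  apply: (@preimage_closed _ _ (fun c : 'rV[R]_n => c ord0 i) [set x | 0 <= x]);
    last exact: closed_ge.
  by move=> c _; exact: coord_continuous.
have S0 : S !=set0.
  exists (\row_i (i == i0)%:R); split => [i|]; first by rewrite mxE ler0n.
  rewrite (bigD1 i0) //= mxE eqxx big1 ?addr0 // => i /negPf ii0.
  by rewrite mxE ii0.
pose comb (c : 'rV[R]_n) := \sum_i c ord0 i *: a i.
pose f c := - q (u - comb c) (u - comb c).
have fE c : f c = - q u u + (\sum_i c ord0 i * (2 * q (a i) u))
    - \sum_i (c ord0 i * \sum_j c ord0 j * q (a j) (a i)).
  rewrite /f /comb qBl !qBr (qC u) !q_suml.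
  have e1 : \sum_i q (c ord0 i *: a i) u = \sum_i c ord0 i * q (a i) u.
    by apply: eq_bigr => i _; rewrite qZl.
  have e2 : \sum_i q (c ord0 i *: a i) (\sum_j c ord0 j *: a j)
      = \sum_i c ord0 i * \sum_j c ord0 j * q (a j) (a i).
    apply: eq_bigr => i _; rewrite qZl qC q_suml; congr (_ * _).
    by apply: eq_bigr => j _; rewrite qZl.
  have e3 : \sum_i c ord0 i * (2 * q (a i) u) = 2 * \sum_i c ord0 i * q (a i) u.
    by rewrite mulr_sumr; apply: eq_bigr => i _; rewrite mulrCA.
  by rewrite e1 e2 e3; ring.
have cf : continuous f.
  have -> : f = fun c => - q u u + (\sum_i c ord0 i * (2 * q (a i) u))
    - \sum_i (c ord0 i * \sum_j c ord0 j * q (a j) (a i)) by exact/funext.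
  have csum (g : 'I_n -> 'rV[R]_n -> R) : (forall i, continuous (g i)) ->
      continuous (fun c => \sum_i g i c).
    by move=> cg; apply: continuous_big => //; exact: add_continuous.
  have ccoord i : continuous (fun c : 'rV[R]_n => c ord0 i) by exact: coord_continuous.
  have c1 : continuous (fun c : 'rV[R]_n => \sum_i c ord0 i * (2 * q (a i) u)).
    by apply: csum => i c; exact: (cvgM (ccoord i c) (cvg_cst _)).
  have c2 i : continuous (fun c : 'rV[R]_n => \sum_j c ord0 j * q (a j) (a i)).
    by apply: csum => j c; exact: (cvgM (ccoord j c) (cvg_cst _)).
  have c3 : continuous (fun c : 'rV[R]_n => \sum_i c ord0 i * \sum_j c ord0 j * q (a j) (a i)).
    by apply: csum => i c; exact: (cvgM (ccoord i c) (c2 i c)).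
  move=> c; exact: (cvgB (cvgD (cvg_cst _) (c1 c)) (c3 c)).
have [c /set_mem Sc cmax] := compact_EVT_max S0 cS (continuous_subspaceT cf).
exists (fun i => c ord0 i); split; [by case: Sc | by case: Sc | move=> s j].
have h t : 0 <= t <= 1 -> 0 <= - 2 * t * q (u - s) (a j - s) + t ^+ 2 * q (a j - s) (a j - s).
  move=> /andP[t0 t1].
  pose c' : 'rV[R]_n := \row_i ((1 - t) * c ord0 i + t * (i == j)%:R).
  have Sc' : S c'.
    split=> [i|]; first by rewrite mxE addr_ge0 // mulr_ge0 ?subr_ge0 //; case: Sc.
    under eq_bigr do rewrite mxE.
    rewrite big_split /= -!mulr_sumr Sc.2 (bigD1 j) //= eqxx big1;
      first by rewrite mulr1n addr0 !mulr1 subrK.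
    by move=> i /negPf ->.
  have c'E : comb c' = s + t *: (a j - s).
    rewrite /comb; under eq_bigr do rewrite mxE scalerDl -!scalerA.
    rewrite big_split /= -!scaler_sumr -/s (bigD1 j) //= eqxx scale1r big1 ?addr0.
      by rewrite scalerBl scale1r scalerBr addrAC addrA.
    by move=> i /negPf ->; rewrite scale0r.
  have := cmax _ (mem_set Sc'); rewrite /f lerN2 c'E -/(comb c) -[comb c]/s opprD addrA.
  by rewrite (qBl _ (t *: _)) !(qBr _ (t *: _)) !(qZl, qZr) (qC (a j - s) (u - s)) expr2; lra.
rewrite leNgt; apply/negP => q0.
set A := q (u - s) _ in h q0; set D := q (a j - s) _ in h.
have D0 : 0 <= D by exact: q_ge0.
have AD : 0 < A + D by lra.
(* A value of [t] in [0, 1] at which - 2 t A + t^2 D is negative. *)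
pose t := A / (A + D).
have tE : t * (A + D) = A by rewrite divfK // gt_eqF.
have t01 : 0 <= t <= 1.
  rewrite divr_ge0 ?(ltW q0) ?(ltW AD) //= ler_pdivrMr //; lra.
have tp : 0 < t by rewrite divr_gt0.
have := h t t01; rewrite expr2 => h1.
have : 0 <= t * (- 2 * A + t * D) by lra.
rewrite pmulr_rge0 // => h2.
have h3 : t * A > 0 by exact: mulr_gt0.
lra.
Qed.

(** A Krein-Milman theorem for finitely many extreme points, in which one
farthest point replaces the separation of convex sets.  If [u] is not its nearest
point [s] in the hull of the [a i], then seen from [s - t *: (u - s)] with [t]
large, [u] is farther away than every [a i]; but the farthest point of [F] is
extreme, hence one of the [a i]. *)
Lemma extreme_points_conv (F : set V) n (a : 'I_n -> V) u :
  (forall z, exists2 x, F x & forall y, F y -> q (y - z) (y - z) <= q (x - z) (x - z)) ->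
  extreme_points F `<=` range a -> F u ->
  exists c : 'I_n -> R, [/\ forall i, 0 <= c i, \sum_i c i = 1 & u = \sum_i c i *: a i].
Proof.
move=> far exta Fu.
have ext z : exists j, forall y, F y -> q (y - z) (y - z) <= q (a j - z) (a j - z).
  have [x Fx xfar] := far z.
  by have [j _ jx] := exta _ (farthest_extreme Fx xfar); exists j; rewrite jx.
have [i0 _] := ext 0.
have [c [c0 c1 /=]] := conv_nearest a u i0.
set s := \sum_i _ => near_s; exists c; split => //.
apply: contrapT => /eqP us.
have p0 : 0 < q (u - s) (u - s) by case: iq => _ _; apply; rewrite subr_eq0.
set p := q _ _ in p0.
pose D := \sum_j q (a j - s) (a j - s).
have D0 : 0 <= D by apply: sumr_ge0 => j _; exact: q_ge0.
(* With this [t], [u] beats every [a j] by at least [p + D]. *)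
pose t := D / p.
have t0 : 0 <= t by rewrite divr_ge0 // ltW.
have [j /(_ _ Fu)] := ext (s - t *: (u - s)).
have Dj : q (a j - s) (a j - s) <= D.
  by rewrite /D (bigD1 j) //= lerDl; apply: sumr_ge0 => k _; exact: q_ge0.
have e w : w - (s - t *: (u - s)) = (w - s) + t *: (u - s).
  by rewrite opprB addrA addrAC.
have ee x y : q (x + t *: y) (x + t *: y) = q x x + 2 * (t * q y x) + t * (t * q y y).
  by rewrite !(qDl, qDr, qZl, qZr) (qC x y); ring.
rewrite !e !ee -/p.
have := ler_wpM2l t0 (near_s j); rewrite mulr0.
have tp : t * p = D by rewrite divfK // gt_eqF.
have -> : t * (t * p) = t * D by rewrite tp.
rewrite tp; lra.
Qed.

End InnerForm.

(** * A scalar product for the weak* topology *)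

Section WeakStar.
Context (R : realType) (E X : completeNormedModType R)
  (pr : {bilinear E -> X -> R | *%R & *%R}).
Hypothesis X_dual : dual_pairing pr.
Implicit Types (eta : E) (u v : X).

Lemma prBl eta eta' u : pr (eta - eta') u = pr eta u - pr eta' u.
Proof. exact: (linearBl pr u). Qed.
Lemma prZl (a : R) eta u : pr (a *: eta) u = a * pr eta u.
Proof. exact: (linearZl_LR pr u). Qed.
Lemma prDr eta u v : pr eta (u + v) = pr eta u + pr eta v.
Proof. exact: (linearDr pr eta). Qed.
Lemma prBr eta u v : pr eta (u - v) = pr eta u - pr eta v.
Proof. exact: (linearBr pr eta). Qed.
Lemma prZr (a : R) eta u : pr eta (a *: u) = a * pr eta u.
Proof. exact: (linearZr_LR pr eta). Qed.
Lemma pr0l u : pr 0 u = 0. Proof. exact: (linear0l pr u). Qed.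
Lemma pr0r eta : pr eta 0 = 0. Proof. exact: (linear0r pr eta). Qed.
Lemma pr_sumr eta n (u : 'I_n -> X) : pr eta (\sum_i u i) = \sum_i pr eta (u i).
Proof. exact: (linear_sumr pr eta). Qed.

Lemma pr_continuous eta : continuous (pr eta : weak_star pr -> R).
Proof.
move=> u; apply: (@continuous_comp _ _ _ (fun v : weak_star pr => (pr^~ v : {ptws E -> R}))
  (fun f : {ptws E -> R} => f eta)).
  exact: initial_continuous.
exact: (@proj_continuous E (fun=> R) eta).
Qed.

Lemma pr_norm eta u : `|pr eta u| <= `|eta| * `|u|.
Proof.
have unit (e : E) : `|e| <= 1 -> `|pr e u| <= `|u|.
  move=> e1; rewrite -lee_fin X_dual.1; apply: ereal_sup_ubound.
  by exists e.
have [->|e0] := eqVneq eta 0; first by rewrite pr0l !normr0 mul0r.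
have n0 : 0 < `|eta| by rewrite normr_gt0.
have := unit (`|eta|^-1 *: eta); rewrite normrZ prZl normrM.
rewrite ger0_norm ?invr_ge0 // mulVf ?gt_eqF // => /(_ (lexx _)).
by rewrite ler_pdivrMl.
Qed.

Lemma pr_separates u : (forall eta, pr eta u = 0) -> u = 0.
Proof.
move=> h; apply/eqP; rewrite -normr_eq0 eq_le normr_ge0 andbT -lee_fin X_dual.1.
by apply: ge_ereal_sup => _ [eta _ <-]; rewrite h normr0.
Qed.

Hypothesis E_separable : separable E.

(** A dense sequence of the predual, scaled into the unit ball. *)
Lemma norming_sequence : exists e : nat -> E,
  (forall k, `|e k| <= 1) /\ forall u, (forall k, pr (e k) u = 0) -> u = 0.
Proof.
have [D cD dD] := E_separable.
have [D0|[f]] := pfcard_geP cD.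
  have [//||x []] := dD setT; first by exists 0.
  - exact: openT.
  - by rewrite D0.
exists (fun k => (1 + `|f k|)^-1 *: f k); split => [k|u h].
  have p : 0 < 1 + `|f k| by rewrite ltr_pwDl.
  by rewrite normrZ ger0_norm ?invr_ge0 ?(ltW p) // ler_pdivrMl // mulr1 lerDr.
have hD eta : D eta -> pr eta u = 0.
  move=> De; have [k _ <-] := @surj _ _ _ _ f _ De.
  have := h k; rewrite prZl => /eqP; rewrite mulf_eq0 invr_eq0 => /orP[|/eqP //].
  by rewrite gt_eqF // ltr_pwDl.
apply: pr_separates => eta; apply/eqP/negPn/negP => n0.
have r0 : 0 < `|pr eta u| / (1 + `|u|) by rewrite divr_gt0 ?normr_gt0 // ltr_pwDl.
have [||eta' [/=]] := dD (ball eta (`|pr eta u| / (1 + `|u|))).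
- by exists eta; exact: ballxx.
- exact: ball_open.
rewrite -ball_normE /= => lt /hD e0.
have := pr_norm (eta - eta') u; rewrite prBl e0 subr0 leNgt => /negP; apply.
rewrite ltr_pdivlMr ?ltr_pwDl // in lt.
apply: le_lt_trans lt; apply: ler_wpM2l => //; rewrite lerDr //.
Qed.

Section Form.
Variable e : nat -> E.
Hypothesis e1 : forall k, `|e k| <= 1.
Hypothesis esep : forall u, (forall k, pr (e k) u = 0) -> u = 0.

Definition weighted_term u v : R^nat := fun k => 2^-1 ^+ k * (pr (e k) u * pr (e k) v).
(** A scalar product on [X] whose squared norm induces the weak* topology on
bounded sets; this is how the separability of [E] enters. *)
Definition weighted_form u v : R := limn (series (weighted_term u v)).

Lemma pr_e k u : `|pr (e k) u| <= `|u|.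
Proof. by apply: le_trans (pr_norm _ _) _; rewrite ler_piMl. Qed.

Lemma weighted_term_le u v k : `|weighted_term u v k| <= geometric (`|u| * `|v|) 2^-1 k.
Proof.
rewrite /geometric /= normrM ger0_norm ?exprn_ge0 // mulrC.
by apply: ler_wpM2r; rewrite ?exprn_ge0 // normrM; apply: ler_pM => //; exact: pr_e.
Qed.

Lemma weighted_form_cvg u v : series (weighted_term u v) @ \oo --> weighted_form u v.
Proof.
apply: normed_cvg.
apply: (@series_le_cvg _ _ (geometric (`|u| * `|v|) 2^-1)).
- by move=> k; exact: normr_ge0.
- by move=> k; rewrite /geometric /= mulr_ge0 ?exprn_ge0 // mulr_ge0.
- exact: weighted_term_le.
apply: is_cvg_geometric_series; rewrite ger0_norm // invf_lt1 //; lra.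
Qed.

Lemma weighted_term_ge0 u k : 0 <= weighted_term u u k.
Proof. by rewrite /weighted_term mulr_ge0 ?exprn_ge0 // -expr2 sqr_ge0. Qed.

Lemma weighted_form_ge u n : series (weighted_term u u) n <= weighted_form u u.
Proof.
apply: nondecreasing_cvgn_le; last exact: weighted_form_cvg.
apply/nondecreasing_seqP => k.
by rewrite -subr_ge0 seriesSB weighted_term_ge0.
Qed.

Lemma weighted_form_le u n (r : R) : `|u| <= r ->
  weighted_form u u <= series (weighted_term u u) n + 2 * r ^+ 2 * 2^-1 ^+ n.
Proof.
move=> ur; apply: limr_le; first exact: weighted_form_cvg.
exists n => // m /= nm.
suff : series (weighted_term u u) m + 2 * r ^+ 2 * 2^-1 ^+ m
    <= series (weighted_term u u) n + 2 * r ^+ 2 * 2^-1 ^+ n.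
  apply: le_trans; rewrite lerDl !mulr_ge0 ?exprn_ge0 // (le_trans _ ur) //.
rewrite -(subnK nm); elim: (m - n)%N => [|k IH]; first by rewrite add0n.
apply: le_trans IH; rewrite addSn seriesSr (exprS _ (k + n)).
have h : weighted_term u u (k + n) <= r ^+ 2 * 2^-1 ^+ (k + n).
  apply: le_trans (ler_norm _) _; apply: le_trans (weighted_term_le _ _ _) _.
  rewrite /geometric /=; apply: ler_wpM2r; first by rewrite exprn_ge0.
  by rewrite -expr2 ler_pXn2r ?nnegrE // (le_trans _ ur).
lra.
Qed.

Lemma weighted_form_inner : inner_form weighted_form.
Proof.
split.
- move=> a x y z; apply: (@cvg_unique _ _ (series (weighted_term (a *: x + y) z) @ \oo)).
  + exact: Rhausdorff.
  + exact: weighted_form_cvg.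
  rewrite (_ : series _ = fun n =>
      a * series (weighted_term x z) n + series (weighted_term y z) n); last first.
    apply/funext => n; rewrite /series /= mulr_sumr -big_split /=.
    by apply: eq_bigr => k _; rewrite /weighted_term prDr prZr; ring.
  apply: cvgD; last exact: weighted_form_cvg.
  by apply: cvgM; [exact: cvg_cst | exact: weighted_form_cvg].
- move=> x y; rewrite /weighted_form; congr (limn (series _)); apply/funext => k.
  by rewrite /weighted_term (mulrC (pr _ x)).
move=> x x0.
have [k] : exists k, pr (e k) x != 0.
  apply: contrapT => h; move/eqP: x0; apply; apply: esep => k.
  by apply/eqP/negPn/negP => ?; apply: h; exists k.
move=> kx; apply: lt_le_trans (weighted_form_ge x k.+1).
rewrite seriesSr ltr_wpDl //;
  first by rewrite /series /= sumr_ge0 // => j _; exact: weighted_term_ge0.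
by rewrite /weighted_term mulr_gt0 ?exprn_gt0 // ?invr_gt0 // -expr2
  lt_neqAle eq_sym sqrf_eq0 kx sqr_ge0.
Qed.

(** On bounded sets the partial sums, which are weak* continuous, approximate the
series uniformly. *)
Lemma weighted_form_usc (F : set X) (r : R) z : (forall x, F x -> `|x - z| <= r) ->
  forall x, F x -> forall d, 0 < d ->
  \forall y \near (x : weak_star pr), F y ->
    weighted_form (y - z) (y - z) < weighted_form (x - z) (x - z) + d.
Proof.
move=> Fr x Fx d d0.
have [n hn] : exists n, 2 * r ^+ 2 * 2^-1 ^+ n < d / 2.
  have : geometric (2 * r ^+ 2) 2^-1 @ \oo --> (0 : R).
    apply: cvg_geometric; rewrite ger0_norm // invf_lt1 //; lra.
  move=> /cvgrPdist_lt/(_ (d / 2)); rewrite divr_gt0 // => /(_ isT) [n _ /(_ n (leqnn _))] /=.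
  rewrite sub0r normrN => h; exists n.
  by apply: le_lt_trans h; exact: ler_norm.
have cs : continuous (fun y : weak_star pr =>
    series (weighted_term ((y : X) - z) ((y : X) - z)) n).
  rewrite /series /=; apply: continuous_big; first exact: add_continuous.
  move=> k _ y.
  have c1 : pr (e k) ((t : X) - z) @[t --> (y : weak_star pr)] --> pr (e k) ((y : X) - z).
    rewrite prBr; under eq_fun do rewrite prBr.
    exact: (cvgB (@pr_continuous (e k) y) (cvg_cst _)).
  exact: (cvgM (cvg_cst _) (cvgM c1 c1)).
have d20 : 0 < d / 2 by rewrite divr_gt0.
have := continuous_usc (cs x) d20.
apply: filterS => y hy Fy.
have := weighted_form_le n (Fr _ Fy); have := weighted_form_ge (x - z) n.
lra.
Qed.

End Form.

(** Instance of [extreme_points_conv]: on a weak* compact set every point has a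
farthest one for [weighted_form]. *)
Lemma weak_star_krein_milman (F : set X) (r : R) n (a : 'I_n -> X) u :
  compact (F : set (weak_star pr)) -> (forall x, F x -> `|x| <= r) ->
  extreme_points F `<=` range a -> F u ->
  exists c : 'I_n -> R, [/\ forall i, 0 <= c i, \sum_i c i = 1 & u = \sum_i c i *: a i].
Proof.
move=> cF bF exta Fu; have [e [e1 esep]] := norming_sequence.
apply: (extreme_points_conv (weighted_form_inner e1 esep) _ exta Fu) => z.
apply: (@usc_compact_max _ (weak_star pr)) => //; first by exists u.
apply: (@weighted_form_usc e e1 F (r + `|z|)) => x Fx.
by apply: le_trans (ler_normB _ _) _; rewrite lerD2r bF.
Qed.

End WeakStar.

(** * Auxiliary facts: concavity and quantitative independence *)

(** A critical point [c] exists by Rolle; [h1] is positive on the left of [c], so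
[h] exceeds at [c] its value [m] at 0. *)
Lemma no_concave_plateau (R : realType) (h h1 h2 : R -> R) (m : R) :
  {within `[0, 1], continuous h} ->
  (forall t : R, 0 < t < 1 -> is_derive t (1 : R) h (h1 t)) ->
  (forall t : R, 0 < t < 1 -> is_derive t (1 : R) h1 (h2 t)) ->
  (forall t : R, 0 < t < 1 -> h2 t < 0) ->
  h 0 = m -> h 1 = m -> ~ forall t, 0 <= t <= 1 -> h t <= m.
Proof.
move=> ch d1 d2 neg h0 h1E hle.
have [|c c01 dc] := @Rolle R h 0 1 ltr01 _ ch (etrans h0 (esym h1E)).
  by move=> t; rewrite in_itv /= => t01; case: (d1 t t01).
move: c01; rewrite in_itv /= => /andP[c0 c1].
have h1c : h1 c = 0.
  have dc' : is_derive c (1 : R) h (h1 c) by apply: d1; rewrite c0.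
  by rewrite -(@derive_val _ _ _ _ _ _ _ dc') (@derive_val _ _ _ _ _ _ _ dc).
have [||x] := @MVT R h h1 0 c c0.
- move=> t; rewrite in_itv /= => /andP[t0 tc]; apply: d1.
  by rewrite t0 (lt_trans tc).
- apply: continuous_subspaceW ch => t /=; rewrite !in_itv /= => /andP[-> tc].
  exact: le_trans tc (ltW c1).
rewrite in_itv /= => /andP[x0 xc]; rewrite h0 subr0 => hc.
have [||y] := @MVT R h1 h2 x c xc.
- move=> t; rewrite in_itv /= => /andP[t0 tc]; apply: d2.
  by rewrite (lt_trans x0 t0) (lt_trans tc).
- apply: derivable_within_continuous => t; rewrite in_itv /= => /andP[t0 tc].
  have t01 : 0 < t < 1 by rewrite (lt_le_trans x0 t0) (le_lt_trans tc).
  by case: (d2 t t01).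
rewrite in_itv /= => /andP[y0 yc]; rewrite h1c => h1x.
have := neg y; rewrite (lt_trans x0 y0) (lt_trans yc) // => /(_ isT) h2y.
have : h2 y * (c - x) < 0 by rewrite nmulr_rlt0 // subr_gt0.
have := hle c; rewrite (ltW c0) (ltW c1) => /(_ isT) hcm h3.
have : 0 < h1 x * c by apply: mulr_gt0 => //; lra.
lra.
Qed.

Lemma derive1n2E (R : realType) (g g1 : R -> R) (t l : R) : 0 < t < 1 ->
  (forall s : R, 0 < s < 1 -> is_derive s (1 : R) g (g1 s)) ->
  is_derive t (1 : R) g1 l -> derive1n 2 g t = l.
Proof.
move=> t01 d1 d2; rewrite derive1nS derive1n1 derive1E.
have dE : \near t, g1 t = g^`()%classic t.
  have : \forall s \near t, s \in `]0, 1[ by apply: near_in_itvoo; rewrite in_itv.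
  apply: filterS => s; rewrite in_itv /= => s01.
  by rewrite derive1E; have := d1 s s01 => ds; rewrite (@derive_val _ _ _ _ _ _ _ ds).
by have d3 := near_eq_is_derive dE d2; rewrite (@derive_val _ _ _ _ _ _ _ d3).
Qed.

Lemma common_radius (R : realFieldType) n (P : 'I_n -> R -> Prop) :
  (forall i r s, s <= r -> P i r -> P i s) ->
  (forall i, exists2 r, 0 < r & P i r) -> exists2 r, 0 < r & forall i, P i r.
Proof.
move=> mono ex.
have /choice [r rP] : forall i, exists r, 0 < r /\ P i r.
  by move=> i; have [r] := ex i; exists r.
have r0 i : 0 < r i by case: (rP i).
have Pr i : P i (r i) by case: (rP i).
(* The inverse of one plus a sum of inverses is a positive lower bound, also for
   [n = 0]. *)
have p : 0 < 1 + \sum_i (r i)^-1.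
  by rewrite ltr_pwDl // sumr_ge0 // => i _; rewrite invr_ge0 ltW.
exists (1 + \sum_i (r i)^-1)^-1 => [|i]; first by rewrite invr_gt0.
apply: mono (Pr i); rewrite -[leRHS]invrK lef_pV2 ?posrE ?invr_gt0 //.
rewrite (bigD1 i) //= addrCA lerDl addr_ge0 // sumr_ge0 // => j _.
by rewrite invr_ge0 ltW.
Qed.

(** The l^1 lower bound for the [a i] loses at most [k / 2] when each vector moves
by at most [k / 2]. *)
Lemma coercive_perturb (R : realType) (V : normedModType R) n (a z : 'I_n -> V) (k : R) :
  (forall c : 'I_n -> R, k * (\sum_i `|c i|) <= `|\sum_i c i *: a i|) ->
  (forall i, `|z i - a i| <= k / 2) ->
  forall c : 'I_n -> R, k / 2 * (\sum_i `|c i|) <= `|\sum_i c i *: z i|.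
Proof.
move=> ka za c.
have : `|\sum_i c i *: (z i - a i)| <= k / 2 * \sum_i `|c i|.
  apply: le_trans (ler_norm_sum _ _ _) _; rewrite mulr_sumr.
  by apply: ler_sum => i _; rewrite normrZ mulrC ler_wpM2r.
have -> : \sum_i c i *: (z i - a i) = \sum_i c i *: z i - \sum_i c i *: a i.
  by rewrite -sumrB; apply: eq_bigr => i _; rewrite scalerBr.
have := ka c; have := ler_normB (\sum_i c i *: z i) (\sum_i c i *: z i - \sum_i c i *: a i).
rewrite opprB addrCA subrr addr0.
set A := `|_ - _|; set B := `|_|; set C := `|\sum_i _ *: z i|; lra.
Qed.

(** * Existence and optimality for the primal problem *)

Section Problem.
Context (R : realType) (E X Y : completeNormedModType R)
  (pr : {bilinear E -> X -> R | *%R & *%R})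
  (dot : {dot Y for idfun})
  (K : {linear X -> Y}) (Ks : {linear Y -> E}) (G : X -> \bar R).
Hypothesis X_dual : dual_pairing pr.
Hypothesis Y_hilbert : hilbert dot.
Hypothesis Ks_preadjoint : forall (y : Y) (u : X), pr (Ks y) u = dot (K u) y.
Hypothesis G_ge0 : forall u, (0 <= G u)%E.
Hypothesis G_hom : pos_homogeneous G.

Let C : set Y := dual_feasible pr Ks G.

Lemma G0 : G 0 = 0%E.
Proof. by rewrite -[X in G X](scale0r (0 : X)) G_hom // mul0e. Qed.

Lemma G_cases u : G u = +oo%E \/ exists2 g, 0 <= g & G u = g%:E.
Proof.
have := G_ge0 u; case: (G u) => [g|_|//]; last by left.
by rewrite lee_fin => g0; right; exists g.
Qed.

(** Testing the subgradient inequality at 0 and at [2 *: u] gives both inequalities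
between [G u] and the pairing. *)
Lemma subdiff_hom eta u : subdiff pr G u eta ->
  G u = (pr eta u)%:E /\ forall v, ((pr eta v)%:E <= G v)%E.
Proof.
move=> sub; have := sub 0; rewrite G0.
case: (G_cases u) => [->|[g g0 Gu]]; first by rewrite addye // leye_eq.
rewrite Gu sub0r -EFinD lee_fin -scaleN1r (prZr pr) mulN1r => h0.
have := sub (2 *: u); rewrite G_hom // Gu -EFinD -EFinM lee_fin => h2.
have e2 : pr eta (2 *: u - u) = pr eta u.
  by rewrite (prBr pr) (prZr pr); ring.
rewrite e2 in h2.
have gE : g = pr eta u by apply/eqP; rewrite eq_le; apply/andP; split; lra.
split; first by rewrite gE.
move=> v; have := sub v; rewrite Gu -EFinD (prBr pr) gE.
by rewrite addrC subrK.
Qed.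

Lemma subdiff0E eta : subdiff pr G 0 eta <-> forall v, ((pr eta v)%:E <= G v)%E.
Proof.
split=> [/subdiff_hom []//|h v].
by rewrite G0 add0e subr0.
Qed.

Lemma feasibleE p : C p <-> forall v, ((dot (K v) p)%:E <= G v)%E.
Proof.
rewrite /C /dual_feasible /=; split => [/subdiff0E h v|h].
  by rewrite -Ks_preadjoint.
by apply/subdiff0E => v; rewrite Ks_preadjoint.
Qed.

Lemma feasible_closed (p : nat -> Y) p0 :
  (forall k, C (p k)) -> p k @[k --> \oo] --> p0 -> C p0.
Proof.
move=> Cp cp; apply/feasibleE => v.
case: (G_cases v) => [->|[g g0 Gv]]; first exact: leey.
rewrite Gv lee_fin.
have cd : dot (K v) (p k) @[k --> \oo] --> dot (K v) p0 by exact: dot_cvgr.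
rewrite -(cvg_lim _ cd) //; apply: limr_le; first by apply/cvg_ex; eexists; exact: cd.
by apply: nearW => k; have /feasibleE/(_ v) := Cp k; rewrite Gv lee_fin.
Qed.

Hypothesis G_interior : (subdiff pr G 0)^° 0.

(** A ball of radius [r] around 0 in the subdifferential at 0 gives
r |u| = sup (pr (r *: eta) u) <= G u. *)
Lemma G_coercive : exists2 r, 0 < r & forall u g, G u = g%:E -> r * `|u| <= g.
Proof.
have /nbhs_ballP [e /= e0 he] := G_interior.
exists (e / 2) => [|u g Gu]; first by rewrite divr_gt0.
rewrite -ler_pdivlMl ?divr_gt0 // -lee_fin X_dual.1.
apply: ge_ereal_sup => _ [eta eta1 <-]; rewrite lee_fin.
have bnd (eta' : E) : `|eta'| <= 1 -> e / 2 * pr eta' u <= g.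
  move=> h; have /he /subdiff0E/(_ u) : ball (0 : E) e (e / 2 *: eta').
    rewrite -ball_normE /= sub0r normrN normrZ ger0_norm ?divr_ge0 ?(ltW e0) //.
    by apply: (@le_lt_trans _ _ (e / 2)); [rewrite ler_piMr // ltW // divr_gt0 | lra].
  by rewrite Gu (prZl pr) lee_fin.
rewrite ler_pdivlMl ?divr_gt0 // -[X in X * _]ger0_norm ?divr_ge0 ?(ltW e0) // -normrM.
rewrite ler_norml bnd // andbT lerNl -mulrN -mulN1r -(prZl pr).
by apply: bnd; rewrite normrZ normrN1 mul1r.
Qed.

Hypothesis G_convex : convex_efun G.
Hypothesis G_lsc : lower_semicontinuous (G : weak_star pr -> \bar R).
Hypothesis G_compact : forall a : R, 0 <= a ->
     compact ([set u | (G u <= a%:E)%E] : set (weak_star pr)).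

Section Primal.
Variables (y0 w : Y) (lam : R).
Hypothesis lam0 : 0 < lam.

Lemma primal_objE u g : G u = g%:E ->
  primal_obj K G y0 w lam u = (2^-1 * `|K u - y0 - w| ^+ 2 + lam * g)%:E.
Proof. by rewrite /primal_obj => ->. Qed.

(** The objective is weak* lower semicontinuous: the quadratic term because it
dominates the affine functions dot p (K u - y0 - w) - |p|^2 / 2, with equality at
the point where p = K u - y0 - w.  Restricting to the sublevel set of [G] given by
the value of the objective at 0 loses no minimizer. *)
Lemma primal_exists : exists u, primal_sol K G y0 w lam u.
Proof.
pose a := lam^-1 * (2^-1 * `|K 0 - y0 - w| ^+ 2).
have a0 : 0 <= a by rewrite mulr_ge0 ?invr_ge0 ?(ltW lam0) // mulr_ge0 // sqr_ge0.
pose S := [set u | (G u <= a%:E)%E].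
have S0 : S 0 by rewrite /S /= G0 lee_fin.
have Sfin u : S u -> exists2 g, 0 <= g & G u = g%:E.
  by rewrite /S /=; case: (G_cases u) => [->|//]; rewrite leye_eq.
pose f u := - (2^-1 * `|K u - y0 - w| ^+ 2 + lam * fine (G u)).
have [|x Sx fmax] := @usc_compact_max R (weak_star pr) S f (G_compact a0) (ex_intro _ 0 S0).
  move=> x Sx e e0; have [g g0 Gx] := Sfin _ Sx.
  pose p := K x - y0 - w.
  have : (((g - e / (2 * lam))%:E) < G x)%E.
    by rewrite Gx lte_fin ltrBlDr ltrDl divr_gt0 // mulr_gt0.
  move=> /(G_lsc (x := x)) [V nV hV].
  have e20 : 0 < e / 2 by rewrite divr_gt0.
  have /cvgrPdist_lt/(_ _ e20) := @pr_continuous _ _ _ pr (Ks p) x.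
  move=> nU; near=> y => Sy.
  have [gy gy0 Gy] := Sfin _ Sy.
  have /hV : V y by near: y.
  rewrite Gy lte_fin => hG.
  have : `|pr (Ks p) x - pr (Ks p) y| < e / 2 by near: y.
  rewrite !Ks_preadjoint ltr_distl => /andP[_ hp].
  rewrite /f Gx Gy /= -/p.
  have := normB_sqr Y_hilbert (K y - y0 - w) p; have := sqr_ge0 `|K y - y0 - w - p|.
  have -> : dot (K y - y0 - w) p = dot (K y) p - dot (K x) p + `|p| ^+ 2.
    rewrite -(dot_norm Y_hilbert) -dotBl -dotDl; congr (dot _ p).
    by rewrite /p !addrA subrK.
  have : lam * (g - e / (2 * lam)) < lam * gy by rewrite ltr_pM2l.
  have -> : lam * (g - e / (2 * lam)) = lam * g - e / 2.
    by field; rewrite gt_eqF.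
  lra.
exists x => v; have [g g0 Gx] := Sfin _ Sx.
rewrite (primal_objE Gx).
case: (G_cases v) => [Gv|[gv gv0 Gv]].
  by rewrite /primal_obj Gv gt0_muley ?lte_fin // addey // leey.
rewrite (primal_objE Gv) lee_fin.
have fle u gu : S u -> G u = gu%:E -> 2^-1 * `|K x - y0 - w| ^+ 2 + lam * g
    <= 2^-1 * `|K u - y0 - w| ^+ 2 + lam * gu.
  by move=> Su Gu; have := fmax _ Su; rewrite /f Gx Gu /= lerN2.
have [Sv|] := pselect (S v); first exact: fle.
rewrite /S /= Gv lee_fin => /negP; rewrite -ltNge => agv.
apply: le_trans (fle 0 0 S0 G0) _; rewrite mulr0 addr0.
have -> : 2^-1 * `|K 0 - y0 - w| ^+ 2 = lam * a by rewrite /a mulVKf // gt_eqF.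
have : lam * a <= lam * gv by rewrite ler_pM2l // ltW.
have := sqr_ge0 `|K v - y0 - w|; lra.
Unshelve. all: by end_near.
Qed.

(** First-order condition: move from [u] towards [v] by [t] and let [t] tend to 0. *)
Lemma primal_subdiff u : primal_sol K G y0 w lam u ->
  subdiff pr G u (Ks (lam^-1 *: (y0 + w - K u))).
Proof.
move=> sol; have [g g0 Gu] : exists2 g, 0 <= g & G u = g%:E.
  case: (G_cases u) => // Gu; have := sol 0.
  by rewrite (primal_objE G0) /primal_obj Gu gt0_muley ?lte_fin // addey // leye_eq.
move=> v; rewrite Gu.
case: (G_cases v) => [->|[gv gv0 Gv]]; first exact: leey.
rewrite Gv -EFinD lee_fin Ks_preadjoint linearB dotC dotZl.
rewrite -(ler_pM2l lam0) mulrDr mulrA mulfV ?gt_eqF // mul1r.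
set D := K v - K u; set r := y0 + w - K u.
have main t : 0 < t -> t < 1 ->
    0 <= t * (lam * (gv - g) - dot r D) + t ^+ 2 * (2^-1 * `|D| ^+ 2).
  move=> t0 t1; have t01 : 0 <= t <= 1 by rewrite !ltW.
  have := G_convex v u t01; rewrite Gu Gv -!EFinM -EFinD => cvx.
  have [//|[gt gt0 Gt]] := G_cases (t *: v + (1 - t) *: u).
    by move=> Gt; move: cvx; rewrite Gt leye_eq.
  have := sol (t *: v + (1 - t) *: u).
  rewrite (primal_objE Gu) (primal_objE Gt) lee_fin.
  rewrite Gt lee_fin in cvx.
  have -> : K (t *: v + (1 - t) *: u) - y0 - w = t *: D - r.
    rewrite linearD !linearZ /= /D /r scalerBl scale1r scalerBr opprB opprD !addrA.
    by congr (_ - _ - _); rewrite -!addrA; congr (_ + _); rewrite addrC.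
  have -> : K u - y0 - w = - r by rewrite /r opprB opprD addrA.
  rewrite normrN (normB_sqr Y_hilbert (t *: D) r) dotZl normrZ exprMn (dotC dot D r)
    (ger0_norm (ltW t0)) => h.
  have : lam * gt <= lam * (t * gv + (1 - t) * g) by rewrite ler_pM2l.
  lra.
suff : 0 <= lam * (gv - g) - dot r D by lra.
rewrite leNgt; apply/negP; move: main; set A := lam * _ - _ => main A0.
set B := 2^-1 * _ in main; have B0 : 0 <= B by rewrite mulr_ge0 // sqr_ge0.
(* Small enough for t A + t^2 B to be negative. *)
pose t := - A / (2 * (B - A)).
have BA : 0 < B - A by lra.
have t0 : 0 < t by rewrite divr_gt0 ?mulr_gt0 // oppr_gt0.
have tE : t * (2 * (B - A)) = - A by rewrite divfK // gt_eqF // mulr_gt0.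
have t1 : t < 1 by rewrite ltr_pdivrMr ?mulr_gt0 //; lra.
have := main t t0 t1; rewrite expr2 -mulrA -mulrDr pmulr_rge0 //.
have : t * A < 0 by rewrite pmulr_rlt0.
lra.
Qed.

(** With p = (y0 + w - K u) / lam, the dual objective at a feasible [q] equals the
one at [p] plus lam (K u, q - p) - lam^2 |q - p|^2 / 2, where the first term is
nonpositive.  So [p] is the only maximizer. *)
Lemma primal_dual u : primal_sol K G y0 w lam u ->
  let p := p_tilde pr dot Ks G y0 w lam in
  [/\ K u = y0 + w - lam *: p, G u = (dot (K u) p)%:E & reg_vi dot C (y0 + w) lam p].
Proof.
move=> sol; set p := lam^-1 *: (y0 + w - K u).
have [Gu feas] := subdiff_hom (primal_subdiff sol).
rewrite -/p in Gu feas.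
have Ku : K u = y0 + w - lam *: p.
  by rewrite /p scalerA mulfV ?gt_eqF // scale1r opprB addrC subrK.
have Cp : C p by apply/feasibleE => v; rewrite -Ks_preadjoint.
clearbody p.
have vi q : C q -> dot (K u) (q - p) <= 0.
  move=> /feasibleE /(_ u); rewrite Gu lee_fin Ks_preadjoint dotBr; lra.
have gap q : C q -> dual_obj dot y0 w lam q + lam ^+ 2 / 2 * `|q - p| ^+ 2
    <= dual_obj dot y0 w lam p.
  move=> /vi; rewrite /dual_obj (normB_sqr Y_hilbert).
  have -> : y0 + w = K u + lam *: p by rewrite Ku subrK.
  rewrite dotBr !dotDl !dotZl (dot_norm Y_hilbert) (dotC dot q p) => h.
  have : lam * (dot (K u) q - dot (K u) p) <= 0 by rewrite pmulr_rle0.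
  by rewrite expr2; lra.
have -> : p_tilde pr dot Ks G y0 w lam = p.
  apply: xget_unique.
    split=> // q /gap; apply: le_trans.
    by rewrite lerDl mulr_ge0 ?sqr_ge0 // divr_ge0 // sqr_ge0.
  move=> q [Cq qmax]; have := gap _ Cq; have := qmax _ Cp => h1 h2.
  have : lam ^+ 2 / 2 * `|q - p| ^+ 2 <= 0 by lra.
  rewrite pmulr_rle0 ?divr_gt0 ?exprn_gt0 // => h3.
  have : `|q - p| ^+ 2 == 0 by rewrite eq_le h3 sqr_ge0.
  by rewrite sqrf_eq0 normr_eq0 subr_eq0 => /eqP.
split => //; first by rewrite Gu Ks_preadjoint.
split => // q /vi; rewrite Ku; exact.
Qed.

End Primal.
End Problem.

(** * Dual certificates and their atoms *)

Section Certificates.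
Context (R : realType) (E X Y : completeNormedModType R)
  (pr : {bilinear E -> X -> R | *%R & *%R})
  (dot : {dot Y for idfun})
  (K : {linear X -> Y}) (Ks : {linear Y -> E}) (G : X -> \bar R).
Hypothesis X_dual : dual_pairing pr.
Hypothesis Y_hilbert : hilbert dot.
Hypothesis Ks_preadjoint : forall (y : Y) (u : X), pr (Ks y) u = dot (K u) y.
Hypothesis G_ge0 : forall u, (0 <= G u)%E.
Hypothesis G_hom : pos_homogeneous G.
Hypothesis G_convex : convex_efun G.
Hypothesis G_lsc : lower_semicontinuous (G : weak_star pr -> \bar R).
Hypothesis G_compact : forall a : R, 0 <= a ->
     compact ([set u | (G u <= a%:E)%E] : set (weak_star pr)).
Hypothesis G_interior : (subdiff pr G 0)^° 0.

Let C : set Y := dual_feasible pr Ks G.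
Let cB : set X := ext_closure pr G.

(** The projections exist because the primal problems have solutions; their limit
for w = 0 comes from [reg_vi_cvg], and [reg_vi_lip] absorbs the noise. *)
Lemma certificates_cvg (u0 : X) (y0 : Y) : y0 = K u0 ->
  (range Ks `&` subdiff pr G u0) !=set0 ->
  C (p_zero pr dot Ks G y0) /\
  forall e, 0 < e -> exists a l : R, [/\ 0 < a, 0 < l & forall lam w,
    0 < lam <= l -> `|w| <= a * lam ->
    `|p_tilde pr dot Ks G y0 w lam - p_zero pr dot Ks G y0| <= e].
Proof.
move=> y0E [_ [[ps _ <-] subps]].
have vi w lam : 0 < lam -> reg_vi dot C (y0 + w) lam (p_tilde pr dot Ks G y0 w lam).
  move=> l0.
  have [u sol] := primal_exists Y_hilbert Ks_preadjoint G_ge0 G_hom G_lsc G_compact y0 w l0.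
  by have [] := primal_dual Y_hilbert Ks_preadjoint G_ge0 G_hom G_convex l0 sol.
have hard : hard_sol dot C y0 ps.
  have [Gu0 feas] := subdiff_hom G_ge0 G_hom subps.
  have Cps : C ps by apply/(feasibleE Ks_preadjoint G_ge0 G_hom) => v; rewrite -Ks_preadjoint.
  split=> // q /(feasibleE Ks_preadjoint G_ge0 G_hom)/(_ u0).
  by rewrite Gu0 Ks_preadjoint y0E lee_fin.
have [||p0 [[hp0 minp0 unip0] cvg]] :=
    @reg_vi_cvg _ _ _ Y_hilbert C y0 _ _ (ex_intro _ ps hard).
- move=> v v0; exact: (feasible_closed Y_hilbert Ks_preadjoint G_ge0 G_hom).
- move=> lam l0; exists (p_tilde pr dot Ks G y0 0 lam).
  by have := vi 0 _ l0; rewrite addr0.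
have -> : p_zero pr dot Ks G y0 = p0.
  apply: xget_unique => [//|q [hq minq]].
  by apply: unip0 => //; exact: minq.
split; first by case: hp0.
move=> e e0; have e20 : 0 < e / 2 by rewrite divr_gt0.
have [l l0 hl] := cvg _ e20.
exists (e / 2), l; split => // lam w /andP[lam0 laml] wl.
have := vi 0 _ lam0; rewrite addr0 => vi0.
have := hl lam _ _ vi0; rewrite lam0 => /(_ laml) h1.
have := reg_vi_lip Y_hilbert lam0 vi0 (vi w _ lam0).
have : `|w| / lam <= e / 2 by rewrite ler_pdivrMr.
have := ler_distD (p_tilde pr dot Ks G y0 0 lam) (p_tilde pr dot Ks G y0 w lam) p0.
lra.
Qed.

Lemma ext_closure_sublevel : cB `<=` [set u | (G u <= 1)%E].
Proof.
move=> u cu /=; rewrite leNgt; apply/negP => /(G_lsc (x := u)) [V nV hV].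
have [v [[Bv _] /hV]] := cu _ nV.
by rewrite ltNge Bv.
Qed.

Lemma ext_closure_compact : compact (cB : set (weak_star pr)).
Proof.
have cl : closed (cB : set (weak_star pr)) by exact: closed_closure.
exact: (subclosed_compact cl (G_compact ler01) ext_closure_sublevel).
Qed.

Lemma sublevel_bounded : exists r, forall u, (G u <= 1)%E -> `|u| <= r.
Proof.
have [r r0 hr] := G_coercive X_dual G_ge0 G_hom G_interior.
exists r^-1 => u Gu.
case: (G_cases G_ge0 u) => [Gy|[g g0 Gg]]; first by move: Gu; rewrite Gy leye_eq.
rewrite Gg lee_fin in Gu.
by rewrite -[leRHS]mulr1 ler_pdivlMl // (le_trans (hr _ _ Gg)).
Qed.

Lemma pairing_le1 p u : C p -> (G u <= 1)%E -> pr (Ks p) u <= 1.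
Proof.
move=> /(feasibleE Ks_preadjoint G_ge0 G_hom)/(_ u) h Gu.
by rewrite Ks_preadjoint -lee_fin (le_trans h).
Qed.

(** [pr (Ks p)] is at most 1 on the sublevel set, so the set where it equals 1 is a
face: it contains every segment of the sublevel set that has one of its points
as an interior point. *)
Lemma face_extreme p : C p ->
  extreme_points [set v | (G v <= 1)%E /\ pr (Ks p) v = 1] `<=`
    cB `&` [set v | pr (Ks p) v = 1].
Proof.
move=> Cp u [[Bu pu] ext]; split => //; apply: subset_closure; split => // v w t Bv Bw t01 uE.
have := pairing_le1 Cp Bv; have := pairing_le1 Cp Bw => hw hv.
have hE : pr (Ks p) u = t * pr (Ks p) v + (1 - t) * pr (Ks p) w.
  by rewrite uE (prDr pr) !(prZr pr).
rewrite pu in hE.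
move/andP: (t01) => [t0 t1].
have : t * pr (Ks p) v <= t * 1 by rewrite ler_pM2l.
have : (1 - t) * pr (Ks p) w <= (1 - t) * 1 by rewrite ler_pM2l ?subr_gt0.
move=> h1 h2; apply: (ext v w t) => //; split => //.
- apply/eqP; rewrite eq_le hv /= -(ler_pM2l t0); lra.
- have t1' : 0 < 1 - t by rewrite subr_gt0.
  apply/eqP; rewrite eq_le hw /= -(ler_pM2l t1'); lra.
Qed.

Hypothesis E_separable : separable E.

(** After rescaling, [u] lies in the face, where [weak_star_krein_milman] applies.
The [a i] need not all be atoms: since the pairings with [Ks p] are at most 1 and
average to 1, those with a nonzero coefficient are.  This allows an arbitrary
filler for the indices that have no atom. *)
Lemma atomic_decomposition p n (a : 'I_n -> X) u : C p ->
  (forall i, cB (a i)) ->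
  (forall v, cB v -> pr (Ks p) v = 1 -> exists i, v = a i) ->
  G u = (pr (Ks p) u)%:E ->
  exists c : 'I_n -> R, [/\ forall i, 0 <= c i,
    forall i, c i != 0 -> pr (Ks p) (a i) = 1 & u = \sum_i c i *: a i].
Proof.
move=> Cp cBa atoms Gu.
set g := pr (Ks p) u in Gu.
have g0 : 0 <= g by rewrite -lee_fin -Gu.
have [g00|gn0] := eqVneq g 0.
  exists (fun=> 0); split => // [i|]; first by rewrite eqxx.
  have [r r0 /(_ _ _ Gu)] := G_coercive X_dual G_ge0 G_hom G_interior.
  rewrite g00 pmulr_rle0 // normr_le0 => /eqP ->.
  by rewrite big1 // => i _; rewrite scale0r.
have gp : 0 < g by rewrite lt_neqAle eq_sym gn0.
pose F := [set v | (G v <= 1)%E /\ pr (Ks p) v = 1].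
have cF : compact (F : set (weak_star pr)).
  have -> : F = [set v | (G v <= 1)%E] `&` [set v | pr (Ks p) v = 1] by [].
  apply: subclosed_compact (G_compact ler01) _; last by move=> v [].
  have cl : closed ([set v | pr (Ks p) v = 1] : set (weak_star pr)).
    by apply: closed_level; exact: pr_continuous.
  apply: closedI => //.
  move=> v cv /=; rewrite leNgt; apply/negP => /(G_lsc (x := v)) [V nV hV].
  have [w [Bw /hV]] := cv _ nV.
  by rewrite ltNge Bw.
have [r bF] := sublevel_bounded.
have Fu : F (g^-1 *: u).
  split; last by rewrite (prZr pr) mulVf.
  by rewrite G_hom ?invr_ge0 // Gu -EFinM mulVf.
have exta : extreme_points F `<=` range a.
  move=> v /(face_extreme Cp) [cv /= pv]; have [i ->] := atoms _ cv pv.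
  by exists i.
have [c [c0 c1 uE]] :=
  weak_star_krein_milman X_dual E_separable cF (fun v Fv => bF _ Fv.1) exta Fu.
exists (fun i => g * c i); split => [i|i gc|]; first by rewrite mulr_ge0.
  have ale j : pr (Ks p) (a j) <= 1.
    by apply: (pairing_le1 Cp); exact: ext_closure_sublevel.
  have s0 : \sum_j c j * (1 - pr (Ks p) (a j)) = 0.
    under eq_bigr do rewrite mulrBr mulr1.
    rewrite sumrB c1; have := Fu.2; rewrite uE (pr_sumr pr).
    by under eq_bigr do rewrite (prZr pr); move=> ->; rewrite subrr.
  have /allP/(_ i (mem_index_enum _)) :
      all (fun j => true ==> (c j * (1 - pr (Ks p) (a j)) == 0)) (index_enum 'I_n).
    rewrite -psumr_eq0 ?s0 // => j _; apply: mulr_ge0 => //.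
    by rewrite subr_ge0.
  rewrite /= mulf_eq0 subr_eq0 => /orP[/eqP ci0|/eqP <- //].
  by move: gc; rewrite ci0 mulr0 eqxx.
under eq_bigr do rewrite -scalerA.
by rewrite -scaler_sumr -uE scalerA mulfV // scale1r.
Qed.

Variable d : X -> X -> R.
Hypothesis d_metrizes : metrizes_on (cB : set (weak_star pr)) d.

Lemma metric_near v e : cB v -> 0 < e ->
  \forall x \near (v : weak_star pr), cB x -> d x v < e.
Proof.
move=> cv e0.
have PF : ProperFilter (within cB (nbhs (v : weak_star pr))).
  apply: Build_ProperFilter_ex => P /nbhs_singleton Pv; exists v; exact: Pv.
have [h _] := d_metrizes.2 (within cB (nbhs (v : weak_star pr))) v PF (withinT _ _) cv.
have /h/cvgrPdist_lt/(_ _ e0) : within cB (nbhs (v : weak_star pr)) --> (v : weak_star pr).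
  exact: cvg_within.
apply: filterS => x.
by rewrite sub0r normrN; apply: le_lt_trans; exact: ler_norm.
Qed.

Lemma metric_cvg (T : Type) (F : set_system T) (FF : ProperFilter F) (f : T -> X) v :
  (\forall t \near F, cB (f t)) -> cB v -> d (f t) v @[t --> F] --> (0 : R) ->
  (f : T -> weak_star pr) t @[t --> F] --> (v : weak_star pr).
Proof.
move=> cf cv h.
have [_ h'] := d_metrizes.2 (f @ F) v _ cf cv.
exact: h'.
Qed.

Hypothesis K_strong : forall (v : nat -> X) (u : X), (forall k, (G (v k) < +oo)%E) ->
     ((v : nat -> weak_star pr) @ \oo --> (u : weak_star pr)) ->
     K (v k) @[k --> \oo] --> K u.

(** A violating sequence would converge weak*, against the strong sequential
continuity of [K]. *)
Lemma K_near v e : cB v -> 0 < e ->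
  exists2 r, 0 < r & forall x, cB x -> d x v <= r -> `|K x - K v| <= e.
Proof.
move=> cv e0; apply: contrapT => h.
have /choice [x hx] : forall k : nat, exists x,
    [/\ cB x, d x v <= k.+1%:R^-1 & e < `|K x - K v|].
  move=> k; apply: contrapT => h'; apply: h.
  exists k.+1%:R^-1; first by rewrite invr_gt0.
  move=> x cx dx; rewrite leNgt; apply/negP => ex.
  by apply: h'; exists x.
have cx k : cB (x k) by case: (hx k).
have xv : (x : nat -> weak_star pr) @ \oo --> (v : weak_star pr).
  apply: metric_cvg => //; first exact: nearW.
  apply/cvgrPdist_le => r r0.
  have /cvgrPdist_le/(_ _ r0) := @cvg_harmonic R.
  apply: filterS => k; rewrite !sub0r !normrN => hr.
  rewrite ger0_norm; last by case: d_metrizes => -[h0 _ _ _] _; exact: h0 (cx k) cv.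
  by apply: le_trans hr; rewrite ger0_norm ?harmonic_ge0 //; case: (hx k).
have xfin k : (G (x k) < +oo)%E.
  by apply: le_lt_trans (ext_closure_sublevel (cx k)) _; rewrite ltry.
have /cvgrPdist_lt/(_ _ e0) := K_strong xfin xv.
case=> k _ /(_ k (leqnn _)) /=; rewrite distrC ltNge => /negP; apply.
by case: (hx k) => _ _ /ltW.
Qed.

(** Otherwise certificates converging to [eta0] attain 1 at points that stay away
from all the [u0i i]; a weak* cluster point of these would be a further point at
which [eta0] equals 1. *)
Lemma localisation (eta0 : E) n (u0i : 'I_n -> X) e : 0 < e ->
  (forall i, cB (u0i i)) ->
  (forall v, cB v -> pr eta0 v = 1 -> exists i, v = u0i i) ->
  exists2 r, 0 < r & forall eta v, `|eta - eta0| <= r -> cB v -> pr eta v = 1 ->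
    exists i, d v (u0i i) <= e.
Proof.
move=> e0 cu exc; apply: contrapT => h.
have /choice [x hx] : forall k : nat, exists x, exists eta,
    [/\ `|eta - eta0| <= k.+1%:R^-1, cB x, pr eta x = 1 & forall i, e < d x (u0i i)].
  move=> k; apply: contrapT => h'; apply: h.
  exists k.+1%:R^-1; first by rewrite invr_gt0.
  move=> eta x he cx px; apply: contrapT => nx.
  apply: h'; exists x, eta; split=> // i; rewrite ltNge; apply/negP => hi.
  by apply: nx; exists i.
have cx : (x @ \oo) cB by exists 0%N => // k _ /=; case: (hx k) => ? [].
have [v [cv clv]] := @ext_closure_compact (x @ \oo) _ cx.
have [r br] := sublevel_bounded.
have pv : pr eta0 v = 1.
  apply/eqP; rewrite -subr_eq0 -normr_eq0; apply/eqP/le_anti.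
  rewrite normr_ge0 andbT; apply/ler_addgt0Pr => t t0; rewrite add0r.
  have t20 : 0 < t / 2 by rewrite divr_gt0.
  have /cvgrPdist_lt/(_ _ t20) nU := @pr_continuous _ _ _ pr eta0 v.
  have r0 : 0 <= r by rewrite (le_trans _ (br 0 _)) ?G0 // lee_fin.
  have r1 : 0 < r + 1 by rewrite ltr_wpDl.
  have t3 : 0 < t / 2 / (r + 1) by rewrite divr_gt0.
  have nN : (x @ \oo) [set y |
      exists2 eta, `|eta - eta0| <= t / 2 / (r + 1) & cB y /\ pr eta y = 1].
    have /cvgrPdist_le/(_ _ t3) := @cvg_harmonic R.
    apply: filterS => k /=; rewrite sub0r normrN ger0_norm ?harmonic_ge0 // => hk.
    have [eta [he cxk pe _]] := hx k; exists eta => //.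
    exact: le_trans he hk.
  have [y [[eta he [cy py]] hy]] := clv _ _ nN nU.
  have : `|pr eta0 y - 1| <= t / 2.
    have -> : pr eta0 y - 1 = pr (eta0 - eta) y by rewrite (prBl pr) py.
    apply: le_trans (pr_norm X_dual _ _) _.
    rewrite distrC; apply: (@le_trans _ _ (t / 2 / (r + 1) * (r + 1))).
      apply: ler_pM => //; apply: le_trans (br _ (ext_closure_sublevel cy)) _.
      by rewrite lerDl.
    by rewrite divfK ?gt_eqF.
  have := ler_distD (pr eta0 y) (pr eta0 v) 1.
  move: hy; rewrite /=; lra.
have [i vi] := exc _ cv pv.
have nd := metric_near cv e0.
have nN : (x @ \oo) [set y | cB y /\ e < d y v].
  by exists 0%N => // k _ /=; have [eta [_ cxk _ /(_ i)]] := hx k; rewrite -vi.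
have [y [[cy ey] /(_ cy)]] := clv _ _ nN nd.
by rewrite ltNge (ltW ey).
Qed.

(** Along a curve joining two atoms, [pr (Ks p)] equals 1 at both ends, never
exceeds 1, and has second derivative
dot p0 f2 + dot (p - p0) f2 < - delta + |p - p0| M <= 0. *)
Lemma one_atom_per_ball (M : R) (p0 p : Y) (delta e : R) (ui : X) :
  C p ->
  (forall v1 v2, closed_ball_ext pr G d ui e v1 -> closed_ball_ext pr G d ui e v2 -> v1 <> v2 ->
     exists gamma : R -> X,
       [/\ Gamma pr dot K G d M gamma,
           forall t : R, 0 <= t <= 1 -> closed_ball_ext pr G d ui e (gamma t),
           gamma 0 = v1, gamma 1 = v2
         & forall t : R, 0 < t < 1 ->
             derive1n 2 (fun s : R => pr (Ks p0) (gamma s) : R) t < - delta]) ->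
  `|p - p0| * M <= delta ->
  forall v1 v2, closed_ball_ext pr G d ui e v1 -> closed_ball_ext pr G d ui e v2 ->
    pr (Ks p) v1 = 1 -> pr (Ks p) v2 = 1 -> v1 = v2.
Proof.
move=> Cp curves pM v1 v2 b1 b2 e1 e2; apply: contrapT => v12.
have [gam [[gcB gct [f1 [f2 [d1 d2 _ f2M]]]] _ g0 g1 gneg]] := curves _ _ b1 b2 v12.
have prE q : (fun s => pr (Ks q) (gam s)) = (fun s => dot q ((K \o gam) s)).
  by apply/funext => s; rewrite Ks_preadjoint dotC.
apply: (@no_concave_plateau R (fun s => pr (Ks p) (gam s)) (fun s => dot p (f1 s))
  (fun s => dot p (f2 s)) 1).
- apply/subspace_continuousP => t; rewrite /= in_itv /= => t01.
  have PF : ProperFilter (within `[0, 1]%classic (nbhs t)).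
    apply: Build_ProperFilter_ex => P /nbhs_singleton Pt; exists t.
    by apply: Pt; rewrite /= in_itv.
  have cg : (gam : R -> weak_star pr) s @[s --> within `[0, 1]%classic (nbhs t)]
      --> (gam t : weak_star pr).
    apply: metric_cvg; [|exact: gcB|exact: gct].
    by apply: filterS (withinT _ _) => s; rewrite /= in_itv /=; exact: gcB.
  rewrite /from_subspace.
  exact: (cvg_comp _ _ cg (@pr_continuous _ _ _ pr (Ks p) (gam t))).
- by move=> t t01; rewrite prE; exact: d1.
- by move=> t t01; exact: d2.
- move=> t t01.
  have := gneg t t01.
  have -> : derive1n 2 (fun s => pr (Ks p0) (gam s) : R) t = dot p0 (f2 t).
    rewrite prE; apply: (@derive1n2E _ _ (fun s => dot p0 (f1 s)) _ _ t01).
    - by move=> s s01; exact: d1.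
    - exact: d2.
  have := dot_le Y_hilbert (p - p0) (f2 t); rewrite dotBl => h1 h2.
  have : `|p - p0| * `|f2 t| <= `|p - p0| * M by rewrite ler_wpM2l // f2M.
  lra.
- by rewrite g0.
- by rewrite g1.
- by move=> t t01; apply: (pairing_le1 Cp); apply: ext_closure_sublevel; exact: gcB.
Qed.

End Certificates.

(** * Exact support recovery *)

Theorem theorem5p1
  (R : realType) (E X Y : completeNormedModType R)
  (pr : {bilinear E -> X -> R | *%R & *%R})
  (E_separable : separable E)
  (X_dual : dual_pairing pr)
  (dot : {dot Y for idfun}) (Y_hilbert : hilbert dot)
  (K : {linear X -> Y})
  (K_weak : continuous (K : weak_star pr -> weak Y))
  (Ks : {linear Y -> E}) (Ks_cont : continuous Ks)
  (Ks_preadjoint : forall (y : Y) (u : X), pr (Ks y) u = dot (K u) y)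
  (G : X -> \bar R)
  (G_ge0 : forall u, (0 <= G u)%E)
  (G_convex : convex_efun G)
  (G_lsc : lower_semicontinuous (G : weak_star pr -> \bar R))
  (G_hom : pos_homogeneous G)
  (G_compact : forall a : R, 0 <= a ->
     compact ([set u | (G u <= a%:E)%E] : set (weak_star pr)))
  (G_interior : (subdiff pr G 0)^° 0)
  (K_strong : forall (v : nat -> X) (u : X), (forall k, (G (v k) < +oo)%E) ->
     ((v : nat -> weak_star pr) @ \oo --> (u : weak_star pr)) ->
     K (v k) @[k --> \oo] --> K u)
  (d : X -> X -> R)
  (d_metrizes : metrizes_on (ext_closure pr G : set (weak_star pr)) d)
  (M : R) (M_gt0 : 0 < M)
  (n : nat) (c0 : 'I_n -> R) (u0i : 'I_n -> X) (u0 : X) (y0 : Y)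
  (c0_gt0 : forall i, 0 < c0 i)
  (u0i_ext : forall i, ext_closure pr G (u0i i) /\ u0i i <> 0)
  (u0_def : u0 = \sum_(i < n) c0 i *: u0i i)
  (y0_def : y0 = K u0)
  (u0_MNDSC : MNDSC pr dot K Ks G d M u0 u0i)
  (K_indep : lin_indep (fun i => K (u0i i))) :
  exists2 eps0 : R, 0 < eps0 &
  forall eps : R, 0 < eps <= eps0 ->
  exists alpha lam0 : R, [/\ 0 < alpha, 0 < lam0 &
  forall (lam : R) (w : Y), noise_set alpha lam0 (lam, w) -> 0 < lam ->
  exists u : X,
    unique (primal_sol K G y0 w lam) u /\
    exists! cv : ('I_n -> R) * ('I_n -> X),
      sparse_rep pr G d (eta_tilde pr dot Ks G y0 w lam) eps c0 u0i u cv].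
Proof.
have [src exc [eps0 [delta [eps0_gt0 delta_gt0 curves]]]] := u0_MNDSC.
rewrite -y0_def in exc curves.
have [p0_feas p0_cvg] := certificates_cvg Y_hilbert Ks_preadjoint
  G_ge0 G_hom G_convex G_lsc G_compact y0_def src.
set p0 := p_zero pr dot Ks G y0 in p0_feas p0_cvg.
exists eps0 => // eps /andP[eps_gt0 eps_le].
have [k k0 coer] := lin_indep_coercive K_indep.
have [m m0 m_c0] : exists2 m, 0 < m & forall i, m < c0 i.
  apply: common_radius => [i r s sr|i]; first exact: le_lt_trans.
  by exists (c0 i / 2); [rewrite divr_gt0 | have := c0_gt0 i; lra].
pose mu := Num.min m eps.
have mu0 : 0 < mu by rewrite lt_min m0.
(* The three contributions to the error of the coefficients, namely the noise, the
   regularization and the displacement of the atoms, must add up to at most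
   k mu / 4, where k / 2 is the constant of independence of the K (atom i). *)
pose S := \sum_i c0 i + 1.
have S0 : 0 < S.
  by rewrite ltr_wpDl // sumr_ge0 // => i _; exact: ltW.
pose tau := Num.min (k / 2) (k * mu / (8 * S)).
have tau0 : 0 < tau by rewrite lt_min !divr_gt0 ?mulr_gt0.
have [r r0 Knear] : exists2 r, 0 < r & forall i, forall x, ext_closure pr G x ->
    d x (u0i i) <= r -> `|K x - K (u0i i)| <= tau.
  apply: common_radius => [i r s sr h x cx dx|i]; first by apply: h => //; exact: le_trans sr.
  by apply: (K_near G_lsc d_metrizes K_strong); case: (u0i_ext i).
pose e := Num.min r eps.
have e0 : 0 < e by rewrite lt_min r0.
have [t t0 loc] : exists2 t, 0 < t & forall eta v, `|eta - eta_zero pr dot Ks G y0| <= t ->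
    ext_closure pr G v -> pr eta v = 1 -> exists i, d v (u0i i) <= e.
  apply: (localisation X_dual G_ge0 G_hom G_lsc G_compact G_interior d_metrizes e0).
    by move=> i; case: (u0i_ext i).
  move=> v cv pv; have : Exc pr dot Ks G y0 v by [].
  by rewrite exc => -[i _ <-]; exists i.
have [t' t'0 Ksnear] : exists2 t', 0 < t' & forall p, `|p - p0| <= t' -> `|Ks p - Ks p0| <= t.
  have /cvgrPdist_le/(_ _ t0)/nbhs_ballP [t' /= t'0 ht] := Ks_cont p0.
  exists (t' / 2) => [|p hp]; first by rewrite divr_gt0.
  rewrite distrC; apply: ht; rewrite -ball_normE /= distrC.
  by apply: le_lt_trans hp _; lra.
(* t' is for the localization, 1 bounds |p_tilde|, delta / M is for the concavity. *)
pose q := Num.min (Num.min t' 1) (delta / M).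
have q0 : 0 < q by rewrite !lt_min t'0 ltr01 divr_gt0.
have [a [l [a0 l0 near_p0]]] := p0_cvg q q0.
pose P := `|p0| + 2.
have P0 : 0 < P by rewrite ltr_wpDl.
exists (Num.min a 1), (Num.min l (k * mu / (8 * P))); split.
- by rewrite lt_min a0 ltr01.
- by rewrite lt_min l0 divr_gt0 ?mulr_gt0.
move=> lam w [/= /andP[_]]; rewrite le_min => /andP[lam_l lam_P] w_le lam0.
set p := p_tilde pr dot Ks G y0 w lam.
have w_a : `|w| <= a * lam.
  by apply: le_trans w_le _; rewrite ler_wpM2r ?(ltW lam0) // ge_min lexx.
have w_1 : `|w| <= lam.
  by apply: le_trans w_le _; rewrite ler_piMl ?(ltW lam0) // ge_min lexx orbT.
have pp0 : `|p - p0| <= q by apply: near_p0 => //; rewrite lam0.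
move: (pp0); rewrite !le_min => /andP[/andP[/Ksnear near_eta pp1] ppd].
rewrite ler_pdivlMr // in ppd.
have [u usol] := primal_exists Y_hilbert Ks_preadjoint G_ge0 G_hom G_lsc G_compact y0 w lam0.
have dual v : primal_sol K G y0 w lam v -> [/\ K v = y0 + w - lam *: p,
    G v = (pr (Ks p) v)%:E & dual_feasible pr Ks G p].
  move=> /(primal_dual Y_hilbert Ks_preadjoint G_ge0 G_hom G_convex lam0) [Kv Gv [Cp _]].
  by split => //; rewrite Ks_preadjoint.
have [Ku Gu Cp] := dual u usol.
have one i v1 v2 : closed_ball_ext pr G d (u0i i) eps0 v1 ->
    closed_ball_ext pr G d (u0i i) eps0 v2 -> pr (Ks p) v1 = 1 -> pr (Ks p) v2 = 1 -> v1 = v2.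
  exact: (one_atom_per_ball Y_hilbert Ks_preadjoint G_ge0 G_hom G_lsc d_metrizes
    Cp (curves i) ppd).
have e_eps : e <= eps by rewrite ge_min lexx orbT.
have ball_e i v : ext_closure pr G v -> d v (u0i i) <= e ->
    closed_ball_ext pr G d (u0i i) eps0 v.
  by move=> cv dv; split => //; apply: le_trans dv (le_trans e_eps eps_le).
have d_u0i i : d (u0i i) (u0i i) = 0.
  by have [cu _] := u0i_ext i; case: d_metrizes => -[_ h _ _] _; apply/(h _ _ cu cu).
(* The balls without an atom are given their centre as a filler. *)
have /choice [atom atomP] : forall i, exists v, [/\ ext_closure pr G v, d v (u0i i) <= e &
    forall v', ext_closure pr G v' -> d v' (u0i i) <= e -> pr (Ks p) v' = 1 -> v' = v].
  move=> i; have [[v [cv dv pv]]|no] := pselect (exists v, [/\ ext_closure pr G v,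
      d v (u0i i) <= e & pr (Ks p) v = 1]).
    by exists v; split=> // v' cv' dv' pv'; apply: (one i) => //; exact: ball_e.
  exists (u0i i); split; [by case: (u0i_ext i) | by rewrite d_u0i ltW |].
  by move=> v' cv' dv' pv'; exfalso; apply: no; exists v'.
have c_atom i : ext_closure pr G (atom i) by case: (atomP i).
have d_atom i : d (atom i) (u0i i) <= e by case: (atomP i).
have atoms v : ext_closure pr G v -> pr (Ks p) v = 1 -> exists i, v = atom i.
  move=> cv pv; have [i dv] := loc _ _ near_eta cv pv.
  by exists i; case: (atomP i) => _ _; apply.
have K_atom i : `|K (atom i) - K (u0i i)| <= tau.
  by apply: Knear => //; apply: le_trans (d_atom i) _; rewrite ge_min lexx.
have tau_k : tau <= k / 2 by rewrite ge_min lexx.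
have tau_mu : tau * (8 * S) <= k * mu.
  by rewrite -ler_pdivlMr ?mulr_gt0 // ge_min lexx orbT.
have coer' := coercive_perturb coer (fun i => le_trans (K_atom i) tau_k).
have indep (c c' : 'I_n -> R) :
    \sum_i c i *: K (atom i) = \sum_i c' i *: K (atom i) -> c = c'.
  move=> cc; apply/funext => i; apply/eqP; rewrite -subr_eq0 -normr_le0.
  have := coer' (fun i => c i - c' i).
  under [X in `|X|]eq_bigr do rewrite scalerBl.
  rewrite sumrB cc subrr normr0 pmulr_rle0 ?divr_gt0 //; apply: le_trans.
  by rewrite (bigD1 i) //= lerDl sumr_ge0.
have Ksum (c : 'I_n -> R) (v : 'I_n -> X) :
    K (\sum_i c i *: v i) = \sum_i c i *: K (v i).
  by rewrite linear_sum; apply: eq_bigr => i _; rewrite linearZ.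
have decomp v : primal_sol K G y0 w lam v -> exists c : 'I_n -> R, [/\ forall i, 0 <= c i,
    forall i, c i != 0 -> pr (Ks p) (atom i) = 1 & v = \sum_i c i *: atom i].
  move=> /dual [_ Gv _].
  exact: (atomic_decomposition X_dual Ks_preadjoint G_ge0 G_hom G_lsc G_compact G_interior
    E_separable Cp c_atom atoms Gv).
have [c [c_ge0 c_act uE]] := decomp u usol.
have c_close i : `|c i - c0 i| <= mu / 2.
  have p_P : `|p| + 1 <= P.
    have := ler_distD 0 p 0; have := ler_normD (p - p0) p0; rewrite subrK /P; lra.
  have res : \sum_i (c i - c0 i) *: K (atom i) =
      w - lam *: p - \sum_i c0 i *: (K (atom i) - K (u0i i)).
    have := Ku; rewrite uE Ksum y0_def u0_def Ksum => h.
    under eq_bigr do rewrite scalerBl.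
    under [in RHS]eq_bigr do rewrite scalerBr.
    rewrite !sumrB h opprB; set A := \sum_i c0 i *: K (u0i i).
    by rewrite -(addrA A w) addrAC addrC.
  have n1 : `|\sum_i c0 i *: (K (atom i) - K (u0i i))| <= tau * S.
    apply: le_trans (ler_norm_sum _ _ _) _.
    apply: (@le_trans _ _ (\sum_i tau * c0 i)).
      apply: ler_sum => j _; rewrite normrZ gtr0_norm // mulrC.
      by rewrite ler_wpM2r // ltW.
    by rewrite -mulr_sumr ler_pM2l // lerDl.
  have n2 : `|w - lam *: p| <= lam * P.
    apply: le_trans (ler_normB _ _) _; rewrite normrZ gtr0_norm //.
    have : lam * (`|p| + 1) <= lam * P by rewrite ler_pM2l.
    lra.
  have n3 : lam * (8 * P) <= k * mu by rewrite -ler_pdivlMr ?mulr_gt0.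
  have := coer' (fun i => c i - c0 i); rewrite res.
  have := ler_normB (w - lam *: p) (\sum_i c0 i *: (K (atom i) - K (u0i i))).
  set A := `|_ - _|; set N := \sum_i `|_| => h1 h2.
  have cN : `|c i - c0 i| <= N.
    by rewrite /N (bigD1 i) //= lerDl sumr_ge0.
  apply: le_trans cN _.
  have : k * N <= k * (mu / 2) by lra.
  by rewrite ler_pM2l.
have mu_m : mu <= m by rewrite ge_min lexx.
have mu_eps : mu <= eps by rewrite ge_min lexx orbT.
have c_gt0 i : 0 < c i.
  have := c_close i; rewrite ler_distl => /andP[h _]; have := m_c0 i; lra.
have p_atom i : pr (Ks p) (atom i) = 1 by apply: c_act; rewrite gt_eqF.
exists u; split.
  split=> // u' usol'; have [Ku' _ _] := dual u' usol'.
  have [c' [_ _ u'E]] := decomp u' usol'.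
  rewrite u'E uE (indep c c') // -!Ksum -uE -u'E Ku Ku' //.
exists (c, atom); split.
  split => //= i; split => //.
  - by split => //; apply: le_trans (d_atom i) e_eps.
  - by move=> at0; have := p_atom i; rewrite at0 (pr0r pr) => /esym/eqP; rewrite oner_eq0.
  - by apply: le_trans (c_close i) _; lra.
move=> [c' v'] [/= uE' rep'].
have v'E : v' = atom.
  apply/funext => i; have [[cv' dv'] _ pv' _ _] := rep' i.
  apply: (one i) => //; last exact: ball_e.
  by split => //; apply: le_trans dv' eps_le.
rewrite v'E in uE' *; congr pair.
by apply: indep; rewrite -!Ksum -uE -uE'.
Qed.
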